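(* Let $N\in\mathbb N$, let $\mathbf s=\{s_i\}_{i=0}^{2n_N-1}$ be a regular sequence of real numbers with set of normal indices $\mathcal N(\mathbf s)=\{n_j\}_{j=1}^N$, let $m_j(z)$, $l_j$ $(1\le j\le N)$ be the Schur parameters defined in the context, and let $$M_j(z)=\begin{pmatrix}1&0\\-zm_j(z)&1\end{pmatrix},\quad L_j=\begin{pmatrix}1&l_j\\0&1\end{pmatrix},\quad W_0(z)=I,\quad W_{2j}(z)=M_1(z)L_1\cdots M_j(z)L_j\quad(1\le j\le N).$$ Then the matrix $W_{2j}(z)$ admits the representation $$W_{2j}(z)=\begin{pmatrix}Q^+_{2j-1}(z)&Q^+_{2j}(z)\\P^+_{2j-1}(z)&P^+_{2j}(z)\end{pmatrix}\quad(j=0,\dots,N),$$ where $P_j^+(z)$ and $Q_j^+(z)$ $(-1\le j\le2N)$ are the Stieltjes polynomials of $\mathbf s$ defined in the context.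
   Context: Matrices. $S_n=(s_{i+j})_{i,j=0}^{n-1}$, $S_n^+=(s_{i+j+1})_{i,j=0}^{n-1}$, $D_n=\det S_n$, $D_n^+=\det S_n^+$. $n\ge1$ is a normal index of $\mathbf s$ if $D_n\ne0$; $n_1<\dots<n_N$. The sequence $\mathbf s=\{s_i\}_{i=0}^{2n_N-1}$ is regular if $D^+_{n_j}\ne0$ for all $j=1,\dots,N$ (equivalently $P_{n_j}(0)\ne0$, with $P_{n_j}$ below). Put $n_{-1}=-1$, $n_0=0$. Polynomials of the first and second kind. $P_{-1}\equiv0$, $P_0\equiv1$, $Q_{-1}\equiv-1$, $Q_0\equiv0$, and for $1\le j\le N$ $$P_{n_j}(z)=\frac1{D_{n_j}}\det\begin{pmatrix}s_0&s_1&\cdots&s_{n_j}\\ \cdots&\cdots&\cdots&\cdots\\ s_{n_j-1}&s_{n_j}&\cdots&s_{2n_j-1}\\1&z&\cdots&z^{n_j}\end{pmatrix},\qquad Q_{n_j}(z)=\mathfrak S_t\left(\frac{P_{n_j}(z)-P_{n_j}(t)}{z-t}\right),$$ where $\mathfrak S_t$ is the linear functional with $\mathfrak S_t(t^i)=s_i$. The numbers $b_j$: $b_0=s_{n_1-1}$, and for $1\le j\le N-1$, $b_j$ is the nonzero real number such that, with a monic polynomial $a_j$ of degree $n_{j+1}-n_j$, both $y=P$ and $y=Q$ satisfy $b_jy_{n_{j-1}}-a_j(z)y_{n_j}+y_{n_{j+1}}=0$. Stieltjes polynomials. $P^+_{-1}\equiv0$, $P_0^+\equiv1$, $Q^+_{-1}\equiv1$,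 $Q^+_0\equiv0$, and for $1\le i\le N$ $$P^+_{2i-1}(z)=\frac{-1}{b_0\cdots b_{i-1}}\begin{vmatrix}P_{n_i}(z)&P_{n_{i-1}}(z)\\P_{n_i}(0)&P_{n_{i-1}}(0)\end{vmatrix},\quad P^+_{2i}(z)=\frac{P_{n_i}(z)}{P_{n_i}(0)},$$ $$Q^+_{2i-1}(z)=\frac{1}{b_0\cdots b_{i-1}}\begin{vmatrix}Q_{n_i}(z)&Q_{n_{i-1}}(z)\\P_{n_i}(0)&P_{n_{i-1}}(0)\end{vmatrix},\quad Q^+_{2i}(z)=-\frac{Q_{n_i}(z)}{P_{n_i}(0)}.$$ Toeplitz notation. $T(c_0,\dots,c_n)$ is the upper triangular $(n+1)\times(n+1)$ matrix with entries $c_{j-i}$ for $i\le j$ and $0$ for $i>j$. Schur parameters (with $\ell=2n_N-1$). Put $\mathbf s^{(0)}=\mathbf s$. Given $\mathbf s^{(j-1)}=\{s_i^{(j-1)}\}_{i=0}^{\ell-2n_{j-1}}$, let $\nu=n_j-n_{j-1}$ (then $s^{(j-1)}_0=\dots=s^{(j-1)}_{\nu-2}=0$, $s^{(j-1)}_{\nu-1}\ne0$), $D_\nu^{(j-1)}=\det(s^{(j-1)}_{i+p})_{i,p=0}^{\nu-1}$, $(D_\nu^{(j-1)})^+=\det(s^{(j-1)}_{i+p+1})_{i,p=0}^{\nu-1}$. Then, for $1\le j\le N$, $$m_j(z)=\frac{(-1)^{\nu+1}}{D_\nu^{(j-1)}}\Delta_j(z)=\sum_{i=0}^{\nu-1}m_i^{(j)}z^i,\qquad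 l_j=(-1)^{\nu+1}s^{(j-1)}_{\nu-1}\frac{D_\nu^{(j-1)}}{(D_\nu^{(j-1)})^+},$$ where $\Delta_j(z)$ is the determinant of the $\nu\times\nu$ matrix whose first $\nu-1$ rows are $(s^{(j-1)}_{i+1},\dots,s^{(j-1)}_{i+\nu})$, $i=0,\dots,\nu-2$, and whose last row is $(1,z,\dots,z^{\nu-1})$. For $1\le j\le N-1$ the sequences $\{\mathfrak s_i^{(j)}\}_{i=-1}^{\ell-2n_j}$ and $\mathbf s^{(j)}=\{s_i^{(j)}\}_{i=0}^{\ell-2n_j}$ are determined by $$T(m^{(j)}_{\nu-1},\dots,m^{(j)}_0,-\mathfrak s^{(j)}_{-1},\dots,-\mathfrak s^{(j)}_{\ell-2n_j})\,T(s^{(j-1)}_{\nu-1},\dots,s^{(j-1)}_{\ell-2n_{j-1}})=I,$$ $$T(l_j,-s_0^{(j)},\dots,-s^{(j)}_{\ell-2n_j})\,T(\mathfrak s^{(j)}_{-1},\dots,\mathfrak s^{(j)}_{\ell-2n_j})=I .$$ *)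

(* Defs.v *)
From mathcomp Require Import all_boot all_order all_algebra.
From mathcomp Require Import zify ring.

Set Implicit Arguments.
Unset Strict Implicit.
Unset Printing Implicit Defensive.

Import Order.TTheory GRing.Theory Num.Theory.
Local Open Scope ring_scope.

(* A finite sequence {s_i}_{i=0}^{l} is a list s with size s = l + 1, and s_i
   is s`_i (which is 0 beyond the end of the list). *)

Definition mx2 (A : Type) (a b c d : A) : 'M[A]_2 :=
  \matrix_(i < 2, j < 2)
    if i == ord0 then (if j == ord0 then a else b)
    else (if j == ord0 then c else d).

Definition hankel (R : fieldType) (s : seq R) (n : nat) : 'M[R]_n :=
  \matrix_(i < n, j < n) s`_(i + j).

Definition hankelp (R : fieldType) (s : seq R) (n : nat) : 'M[R]_n :=
  \matrix_(i < n, j < n) s`_(i + j + 1).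

Definition D (R : fieldType) (s : seq R) (n : nat) : R := \det (hankel s n).

Definition Dp (R : fieldType) (s : seq R) (n : nat) : R := \det (hankelp s n).

(* The middle condition says that the entries s_0, ..., s_{2n-2} of S_n all
   belong to the sequence. *)
Definition normal_index (R : fieldType) (s : seq R) (n : nat) : bool :=
  [&& (1 <= n)%N, (2 * n - 2 < size s)%N & D s n != 0].

Definition regular (R : fieldType) (s : seq R) : Prop :=
  forall n, normal_index s n -> Dp s n != 0.

(* Ppol s m is P_m; Ppol s 0 = 1 since both determinants are then 1. *)
Definition Ppol (R : fieldType) (s : seq R) (m : nat) : {poly R} :=
  (D s m)^-1 *:
    \det (\matrix_(i < m.+1, j < m.+1)
            if (i < m)%N then (s`_(i + j))%:P else 'X^j : {poly R}).

(* In {poly {poly R}} the outer variable 'X is t and the inner one 'X%:P is z,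
   so that p(z) is p%:P and p(t) is p^:P. The division is exact, see ddiffE. *)
Definition ddiff (R : fieldType) (p : {poly R}) : {poly {poly R}} :=
  (p%:P - map_poly polyC p) %/ ('X%:P - 'X).

Definition Sfun (R : fieldType) (s : seq R) (q : {poly {poly R}}) : {poly R} :=
  \sum_(i < size q) s`_i *: q`_i.

Definition Qpol (R : fieldType) (s : seq R) (m : nat) : {poly R} :=
  Sfun s (ddiff (Ppol s m)).

Definition recurrence_numbers (R : fieldType) (s : seq R) (N : nat)
    (n : nat -> nat) (b : nat -> R) : Prop :=
  b 0%N = s`_(n 1%N - 1) /\
  forall j, (1 <= j < N)%N ->
    b j != 0 /\
    exists a : {poly R},
      [/\ a \is monic, size a = (n j.+1 - n j).+1,
          b j *: Ppol s (n j.-1) - a * Ppol s (n j) + Ppol s (n j.+1) = 0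
        & b j *: Qpol s (n j.-1) - a * Qpol s (n j) + Qpol s (n j.+1) = 0].

Definition Pplus_odd (R : fieldType) (s : seq R) (n : nat -> nat) (b : nat -> R)
    (i : nat) : {poly R} :=
  (- 1 / \prod_(k < i) b k) *:
    \det (mx2 (Ppol s (n i)) (Ppol s (n i.-1))
              (Ppol s (n i)).[0]%:P (Ppol s (n i.-1)).[0]%:P).

Definition Pplus_even (R : fieldType) (s : seq R) (n : nat -> nat) (i : nat) :
    {poly R} :=
  ((Ppol s (n i)).[0])^-1 *: Ppol s (n i).

Definition Qplus_odd (R : fieldType) (s : seq R) (n : nat -> nat) (b : nat -> R)
    (i : nat) : {poly R} :=
  (1 / \prod_(k < i) b k) *:
    \det (mx2 (Qpol s (n i)) (Qpol s (n i.-1))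
              (Ppol s (n i)).[0]%:P (Ppol s (n i.-1)).[0]%:P).

Definition Qplus_even (R : fieldType) (s : seq R) (n : nat -> nat) (i : nat) :
    {poly R} :=
  - (((Ppol s (n i)).[0])^-1 *: Qpol s (n i)).

(* The index k runs over -1, 0, 1, ...; every negative k is treated as -1.
   For k = 2i-1 and for k = 2i, uphalf k is i. *)
Definition Pplus (R : fieldType) (s : seq R) (n : nat -> nat) (b : nat -> R)
    (k : int) : {poly R} :=
  match k with
  | Negz _ => 0
  | Posz 0 => 1
  | Posz k => if odd k then Pplus_odd s n b (uphalf k)
              else Pplus_even s n (uphalf k)
  end.

Definition Qplus (R : fieldType) (s : seq R) (n : nat -> nat) (b : nat -> R)
    (k : int) : {poly R} :=
  match k with
  | Negz _ => 1
  | Posz 0 => 0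
  | Posz k => if odd k then Qplus_odd s n b (uphalf k)
              else Qplus_even s n (uphalf k)
  end.

(* toeplitz k c is T(c_0, ..., c_{k-1}). *)
Definition toeplitz (R : fieldType) (k : nat) (c : seq R) : 'M[R]_k :=
  \matrix_(i < k, j < k) if (i <= j)%N then c`_(j - i) else 0.

(* One step of the Schur algorithm; s stands for s^(j-1). *)

Definition schur_Delta (R : fieldType) (s : seq R) (nu : nat) : {poly R} :=
  \det (\matrix_(i < nu, j < nu)
          if (i < nu - 1)%N then (s`_(i + 1 + j))%:P else 'X^j : {poly R}).

Definition schur_m (R : fieldType) (s : seq R) (nu : nat) : {poly R} :=
  ((-1) ^+ (nu + 1) / D s nu) *: schur_Delta s nu.

Definition schur_l (R : fieldType) (s : seq R) (nu : nat) : R :=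
  (-1) ^+ (nu + 1) * s`_(nu - 1) * (D s nu / Dp s nu).

(* The two Toeplitz equations that relate s = s^(j-1) to fs = \mathfrak s^(j)
   and s' = s^(j). The list fs starts at the index -1, i.e.
   fs = [:: \mathfrak s_{-1}; \mathfrak s_0; ...]. *)
Definition schur_step (R : fieldType) (s : seq R) (nu : nat) (fs s' : seq R) :
    Prop :=
  [/\ size fs = (size s - 2 * nu).+1, size s' = (size s - 2 * nu)%N,
      toeplitz (size s - nu).+1
        (rev (mkseq (fun i => (schur_m s nu)`_i) nu) ++ [seq - x | x <- fs])
      *m toeplitz (size s - nu).+1 (drop (nu - 1) s) = 1%:M
    & toeplitz (size s - 2 * nu).+1 (schur_l s nu :: [seq - x | x <- s'])
      *m toeplitz (size s - 2 * nu).+1 fs = 1%:M].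

(* The solution of the two equations, read off from the first rows of the
   inverse Toeplitz matrices; schur_stepP shows that it is the only one. *)
Definition schur_frak (R : fieldType) (s : seq R) (nu : nat) : seq R :=
  mkseq (fun i => - invmx (toeplitz (size s - nu).+1 (drop (nu - 1) s))
                      ord0 (inord (nu + i)))
        (size s - 2 * nu).+1.

Definition schur_next (R : fieldType) (s : seq R) (nu : nat) : seq R :=
  mkseq (fun i => - invmx (toeplitz (size s - 2 * nu).+1 (schur_frak s nu))
                      ord0 (inord i.+1))
        (size s - 2 * nu).

(* schur_seq s n j is s^(j). *)
Fixpoint schur_seq (R : fieldType) (s : seq R) (n : nat -> nat) (j : nat) :
    seq R :=
  if j is i.+1 then schur_next (schur_seq s n i) (n i.+1 - n i) else s.

Definition m_ (R : fieldType) (s : seq R) (n : nat -> nat) (j : nat) :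
    {poly R} :=
  schur_m (schur_seq s n j.-1) (n j - n j.-1).

Definition l_ (R : fieldType) (s : seq R) (n : nat -> nat) (j : nat) : R :=
  schur_l (schur_seq s n j.-1) (n j - n j.-1).

Definition Mmx (R : fieldType) (s : seq R) (n : nat -> nat) (j : nat) :
    'M[{poly R}]_2 :=
  mx2 1 0 (- 'X * m_ s n j) 1.

Definition Lmx (R : fieldType) (s : seq R) (n : nat -> nat) (j : nat) :
    'M[{poly R}]_2 :=
  mx2 1 (l_ s n j)%:P 0 1.

(* W_even s n j is W_{2j}. *)
Definition W_even (R : fieldType) (s : seq R) (n : nat -> nat) (j : nat) :
    'M[{poly R}]_2 :=
  \prod_(1 <= i < j.+1) (Mmx s n i *m Lmx s n i).

Lemma ddiffE (R : fieldType) (p : {poly R}) :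
  ddiff p * ('X%:P - 'X) = p%:P - map_poly polyC p.
Proof.
have lc : lead_coef ('X%:P - 'X : {poly {poly R}}) \is a GRing.unit.
  by rewrite -opprB lead_coefN (monicP (monicXsubC _)) unitrN unitr1.
apply/(Pdiv.IdomainUnit.divpK lc).
rewrite -opprB -scaleN1r (eqp_dvdl _ (eqp_scale _ _)) ?oppr_eq0 ?oner_eq0 //.
rewrite dvdp_XsubCl /root hornerD hornerN hornerC.
by rewrite -/(comp_poly _ _) comp_polyXr subrr.
Qed.

Lemma toeplitz_mul1P (R : fieldType) (k : nat) (c d : seq R) :
  toeplitz k.+1 c *m toeplitz k.+1 d = 1%:M <->
  forall j, (j <= k)%N -> \sum_(i < j.+1) c`_i * d`_(j - i) = (j == 0)%:R.
Proof.
have conv i j : (toeplitz k.+1 c *m toeplitz k.+1 d) i j =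
    if (i <= j)%N then \sum_(p < (j - i).+1) c`_p * d`_(j - i - p) else 0.
  rewrite mxE; under eq_bigr do rewrite !mxE.
  case: leqP => [le_ij|lt_ji]; last first.
    apply: big1 => p _; case: leqP => [le_ip|]; last by rewrite mul0r.
    by rewrite leqNgt (leq_trans lt_ji le_ip) mulr0.
  rewrite -(big_mkord xpredT (fun p => c`_p * d`_(j - i - p))).
  rewrite -(big_mkord xpredT (fun p => (if (i <= p)%N then c`_(p - i) else 0) *
                                    (if (p <= j)%N then d`_(j - p) else 0))).
  rewrite (big_cat_nat (leq0n i)) /=; last by apply: ltnW; apply: ltn_ord.
  rewrite [X in X + _]big_nat big1 ?add0r; last first.
    by move=> p /andP[_ lt_pi]; rewrite leqNgt lt_pi mul0r.
  rewrite (@big_cat_nat _ _ _ j.+1) //=; last exact: leqW.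
  rewrite [X in _ + X]big_nat [X in _ + X]big1 ?addr0; last first.
    by move=> p /andP[lt_jp _]; rewrite [(p <= j)%N]leqNgt lt_jp mulr0.
  rewrite -{1}[val i]add0n big_addn subSn // !big_mkord.
  apply: eq_bigr => p _; have le_p : (p <= j - i)%N by rewrite -ltnS.
  have -> : (p + \val i <= j)%N by rewrite addnC -leq_subRL.
  by rewrite leq_addl addnK addnC subnDA.
split=> [eq1 j le_jk | eqc].
  have := conv ord0 (inord j); rewrite eq1 mxE /= inordK // subn0 => <-.
  by rewrite -val_eqE /= inordK // eq_sym.
apply/matrixP=> i j; rewrite conv mxE -val_eqE /=.
case: leqP => [le_ij|]; last by move=> lt_ji; rewrite gtn_eqF.
rewrite eqc ?subn_eq0; last by rewrite (leq_trans (leq_subr _ _)) // -ltnS.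
by rewrite eqn_leq le_ij.
Qed.

Lemma toeplitz_unit (R : fieldType) (k : nat) (d : seq R) :
  d`_0 != 0 -> toeplitz k.+1 d \in unitmx.
Proof.
move=> d0; rewrite -unitmx_tr unitmxE det_trig.
  rewrite unitfE; apply/prodf_neq0 => i _.
  by rewrite !mxE leqnn subnn.
by apply/is_trig_mxP=> i j lt_ij; rewrite !mxE leqNgt lt_ij.
Qed.

Lemma invmx_toeplitz (R : fieldType) (k : nat) (d : seq R) :
  d`_0 != 0 ->
  invmx (toeplitz k.+1 d) =
    toeplitz k.+1 (mkseq (fun i => invmx (toeplitz k.+1 d) ord0 (inord i)) k.+1).
Proof.
move=> d0; have Ud := toeplitz_unit k d0.
set r := mkseq _ _; suff r1 : toeplitz k.+1 r *m toeplitz k.+1 d = 1%:M.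
  by rewrite -[RHS](mulmxK Ud) r1 mul1mx.
apply/toeplitz_mul1P=> j le_jk.
have /matrixP/(_ ord0 (inord j)) := mulVmx Ud.
rewrite !mxE -val_eqE /= inordK // [in RHS]eq_sym => <-.
have lt_jk : (j.+1 <= k.+1)%N by [].
rewrite (big_ord_widen _ (fun i => r`_i * d`_(j - i)) lt_jk) big_mkcond.
apply: eq_bigr => p _; rewrite !mxE /= inordK // ltnS.
by case: leqP => _; rewrite ?mulr0 // nth_mkseq // inord_val.
Qed.

Lemma toeplitz_nth (R : fieldType) (k : nat) (c d : seq R) :
  toeplitz k.+1 c = toeplitz k.+1 d <->
  forall i, (i <= k)%N -> c`_i = d`_i.
Proof.
split=> [/matrixP eq_cd i le_ik | eq_cd].
  by have := eq_cd ord0 (inord i); rewrite !mxE inordK // leq0n subn0.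
apply/matrixP=> i j; rewrite !mxE; case: leqP => // _.
by rewrite eq_cd // (leq_trans (leq_subr _ _)) // -ltnS.
Qed.

Lemma schur_DeltaE (R : fieldType) (s : seq R) (v i : nat) :
  \sum_(p < v.+1) (schur_Delta s v.+1)`_p * s`_(i + p) =
  \det (\matrix_(a < v.+1, c < v.+1)
          if (a < v)%N then s`_(a + 1 + c) else s`_(i + c)).
Proof.
set B := (X in \det X); rewrite (expand_det_row B ord_max).
suff -> : schur_Delta s v.+1 =
    \sum_(p < v.+1) (cofactor B ord_max p)%:P * 'X^p.
  apply: eq_bigr => p _; rewrite [B _ _]mxE /= ltnn mulrC; congr (_ * _).
  rewrite coef_sum (bigD1 p) //= coefCM coefXn eqxx mulr1 big1 ?addr0 // => q.
  by rewrite -val_eqE eq_sym coefCM coefXn => /negPf->; rewrite mulr0.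
rewrite /schur_Delta (expand_det_row _ ord_max); apply: eq_bigr => p _.
rewrite mxE /= subn1 ltnn mulrC; congr (_ * _).
rewrite -cofactor_map_mx; congr (_ * \det _).
by apply/matrixP=> a c; rewrite !mxE !lift_max /= ltn_ord.
Qed.

Lemma schur_mE (R : fieldType) (s : seq R) (v i : nat) :
  (forall a, (a < v)%N -> s`_a = 0) -> D s v.+1 != 0 -> (i <= v)%N ->
  \sum_(p < v.+1) (schur_m s v.+1)`_p * s`_(i + p) = (i == 0)%:R.
Proof.
move=> s0 nzD le_iv; rewrite /schur_m.
under eq_bigr do rewrite coefZ -mulrA.
rewrite -mulr_sumr schur_DeltaE; case: i le_iv => [|i] le_iv; last first.
  rewrite [\det _](determinant_alternate (i1 := inord i) (i2 := ord_max)).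
  - by rewrite mulr0.
  - by rewrite -val_eqE /= inordK ?ltn_eqF // ltnW.
  by move=> c; rewrite !mxE /= inordK ?ltnn ?le_iv ?addn1 // ltnW.
suff -> : \det (\matrix_(a < v.+1, c < v.+1)
    if (a < v)%N then s`_(a + 1 + c) else s`_(0 + c)) = (-1) ^+ v * D s v.+1.
  rewrite [_ * D _ _]mulrC mulrA mulfVK // -exprD -signr_odd.
  by rewrite !oddD /= addbT negbK addbb.
rewrite /D (expand_det_row _ ord_max) (expand_det_row (hankel _ _) ord0).
rewrite (bigD1 ord_max) //= [X in _ + X]big1 ?addr0; last first.
  move=> p; rewrite -val_eqE /= => ne_pv; rewrite !mxE /= ltnn s0 ?mul0r //.
  by rewrite ltn_neqAle ne_pv -ltnS ltn_ord.
rewrite [in RHS](bigD1 ord_max) //= [X in _ * (_ + X)]big1 ?addr0; last first.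
  move=> p; rewrite -val_eqE /= => ne_pv; rewrite !mxE /= s0 ?mul0r //.
  by rewrite add0n ltn_neqAle ne_pv -ltnS ltn_ord.
rewrite !mxE /= ltnn [RHS]mulrCA; congr (_ * _).
rewrite /cofactor /= add0n mulrA -signr_odd oddD addbb mul1r.
rewrite -expr2 sqrr_sign mul1r; congr (\det _).
by apply/matrixP=> a c; rewrite !mxE !lift_max lift0 ltn_ord addn1.
Qed.

Lemma schur_stepP (R : fieldType) (s fs s' : seq R) (nu : nat) :
  (1 <= nu)%N -> (2 * nu <= size s)%N ->
  (forall i, (i < nu - 1)%N -> s`_i = 0) ->
  D s nu != 0 -> Dp s nu != 0 ->
  schur_step s nu fs s' <-> fs = schur_frak s nu /\ s' = schur_next s nu.
Proof.
case: nu => // v _ le_sz; rewrite subn1 /= => s0 nzD nzDp.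
have nzs : s`_v != 0.
  have := schur_mE s0 nzD (leq0n v); rewrite big_ord_recr /= big1.
    by move=> /eqP; rewrite add0r; apply: contraTneq => ->; rewrite mulr0 eq_sym oner_eq0.
  by move=> p _; rewrite add0n s0 ?mulr0 ?ltn_ord.
set K := (size s - v.+1)%N; set d := drop v s; set L := (size s - 2 * v.+1)%N.
have nzd : d`_0 != 0 by rewrite nth_drop addn0.
have KE : K = (L + v.+1)%N by rewrite /K /L; lia.
have Ud := toeplitz_unit K nzd.
have Ed := invmx_toeplitz K nzd.
set r := mkseq _ _ in Ed.
have rE i : (i <= K)%N -> r`_i = invmx (toeplitz K.+1 d) ord0 (inord i).
  by move=> le_iK; rewrite nth_mkseq.
have r1 : toeplitz K.+1 r *m toeplitz K.+1 d = 1%:M by rewrite -Ed mulVmx.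
have rc := (toeplitz_mul1P _ _ _).1 r1.
clearbody r.
set fr := schur_frak s v.+1.
have sz_fr : size fr = L.+1 by rewrite size_mkseq.
have frE i : (i <= L)%N -> fr`_i = - r`_(v.+1 + i).
  by move=> le_iL; rewrite nth_mkseq // rE ?subn1 //; rewrite KE; lia.
set m := rev (mkseq (fun i => (schur_m s v.+1)`_i) v.+1).
have sz_m : size m = v.+1 by rewrite size_rev size_mkseq.
have mE i : (i <= v)%N -> m`_i = (schur_m s v.+1)`_(v - i).
  by move=> le_iv; rewrite nth_rev size_mkseq // subSS nth_mkseq // ltnS leq_subr.
have msum i : \sum_(p < v.+1) m`_p * s`_(v + i - p) =
              \sum_(p < v.+1) (schur_m s v.+1)`_p * s`_(i + p).
  rewrite [RHS](reindex_inj rev_ord_inj); apply: eq_bigr => p _ /=.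
  have le_pv : (p <= v)%N by rewrite -ltnS.
  by rewrite mE // subSS addnBA // [(i + v)%N]addnC.
have mr i : (i <= v)%N -> m`_i = r`_i.
  move: i; apply/toeplitz_nth.
  have Uv := toeplitz_unit v nzd.
  apply: (can_inj (mulmxK Uv)); transitivity (1%:M : 'M[R]_v.+1); last first.
    symmetry; apply/toeplitz_mul1P=> j le_jv; apply: rc.
    by rewrite KE (leq_trans le_jv) //; lia.
  apply/toeplitz_mul1P=> j le_jv; rewrite -(schur_mE s0 nzD le_jv) -msum.
  have lt_jv : (j.+1 <= v.+1)%N by [].
  rewrite (big_ord_widen _ (fun i => m`_i * d`_(j - i)) lt_jv) big_mkcond.
  apply: eq_bigr => p _; rewrite ltnS; case: leqP => [le_pj|lt_jp].
    by rewrite nth_drop addnBA.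
  have le_pv : (p <= v)%N by rewrite -ltnS.
  by rewrite s0 ?mulr0 //; lia.
have rm fs0 : toeplitz K.+1 (m ++ [seq - x | x <- fs0]) = toeplitz K.+1 r <->
    forall i, (i <= L)%N -> fs0`_i = fr`_i.
  have nthN i : [seq - x | x <- fs0]`_i = - fs0`_i.
    case: (ltnP i (size fs0)) => lt_i; first by rewrite (nth_map 0).
    by rewrite !nth_default ?size_map ?oppr0.
  split=> [/toeplitz_nth eq_r i le_iL | eq_f].
    have := eq_r (v.+1 + i)%N; rewrite KE nth_cat sz_m ltnNge leq_addr /=.
    rewrite addKn nthN frE // => <-; first by rewrite opprK.
    by rewrite addnC leq_add2r.
  apply/toeplitz_nth=> i; rewrite KE => le_iK; rewrite nth_cat sz_m ltnS.
  case: leqP => [/mr // | lt_vi].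
  have le_iL : (i - v.+1 <= L)%N by lia.
  by rewrite nthN eq_f // frE // opprK subnKC.
have lfr : schur_l s v.+1 * fr`_0 = 1.
  have := frE 0%N (leq0n L); rewrite addn0; move: fr`_0 => f0 f0E.
  have lt_vK : (v.+1 <= K)%N by rewrite KE leq_addl.
  have := rc _ lt_vK; rewrite big_ord_recr /= subnn nth_drop addn0.
  under eq_bigr => p _.
    rewrite -mr -1?ltnS // nth_drop addnBA ?(ltnW (ltn_ord p)) //; over.
  rewrite (msum v.+1) => /eqP; rewrite addr_eq0 -mulNr -f0E.
  rewrite /schur_m; under eq_bigr do rewrite coefZ -mulrA.
  rewrite -mulr_sumr schur_DeltaE.
  have -> : \det (\matrix_(a < v.+1, c < v.+1) (if (a < v)%N
      then s`_(a + 1 + c) else s`_(v.+1 + c))) = Dp s v.+1.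
    congr (\det _); apply/matrixP=> a c; rewrite !mxE addn1 [in RHS]addn1.
    by case: ltnP => // le_va; have -> : (a = v :> nat) by have := ltn_ord a; lia.
  move=> /eqP eq_f.
  have -> : f0 = (-1) ^+ (v.+1 + 1) / D s v.+1 * Dp s v.+1 / s`_v.
    by rewrite eq_f mulfK.
  rewrite /schur_l subn1 /= -[RHS](sqrr_sign R (v.+1 + 1)) expr2.
  by field; rewrite nzD nzDp nzs.
have nzf : fr`_0 != 0 by apply: contra_eq_neq lfr => ->; rewrite mulr0 eq_sym oner_neq0.
have Uf := toeplitz_unit L nzf.
have Ef := invmx_toeplitz L nzf.
set q := mkseq _ _ in Ef.
have q1 : toeplitz L.+1 q *m toeplitz L.+1 fr = 1%:M by rewrite -Ef mulVmx.
have q0 : q`_0 = schur_l s v.+1.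
  have := (toeplitz_mul1P _ _ _).1 q1 0%N (leq0n _).
  by rewrite big_ord1 /= -lfr => /(mulIf nzf).
have sz_n : size (schur_next s v.+1) = L by rewrite size_mkseq.
have nE i : (i < L)%N -> (schur_next s v.+1)`_i = - q`_i.+1.
  by move=> lt_iL; rewrite !nth_mkseq.
clearbody q.
have qn s1 : size s1 = L ->
    toeplitz L.+1 (schur_l s v.+1 :: [seq - x | x <- s1]) = toeplitz L.+1 q <->
    s1 = schur_next s v.+1.
  move=> sz1; split=> [/toeplitz_nth eq_q | ->].
    apply: (@eq_from_nth _ 0); rewrite ?sz1 ?sz_n // => i lt_iL.
    by rewrite nE // -eq_q //= (nth_map 0) ?sz1 // opprK.
  apply/toeplitz_nth=> -[|i] lt_iL //=.
  by rewrite (nth_map 0) ?sz_n // nE // opprK.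
have mulIunit k (A B C : 'M[R]_k) : C \in unitmx -> A *m C = 1%:M ->
    B *m C = 1%:M <-> B = A.
  by move=> UC AM; split=> [BM|->//]; apply: (can_inj (mulmxK UC)); rewrite AM.
rewrite /schur_step -/K -/L subn1 /= -/d -/m.
split=> [[sz_fs sz_s'] | [-> ->]].
  move=> /(mulIunit _ _ _ _ Ud r1)/rm eq_f.
  have -> : fs = fr by apply: (@eq_from_nth _ 0); rewrite sz_fs.
  by move=> /(mulIunit _ _ _ _ Uf q1)/(qn _ sz_s').
split=> //; first by apply/(mulIunit _ _ _ _ Ud r1)/rm.
by apply/(mulIunit _ _ _ _ Uf q1)/qn.
Qed.

(* Main.v *)
Require Import Defs.
From mathcomp Require Import all_boot all_order all_algebra.
From mathcomp Require Import zify ring.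
From mathcomp Require Import generic_quotient.
From mathcomp Require Import reals.

Set Implicit Arguments.
Unset Strict Implicit.
Unset Printing Implicit Defensive.

Import Order.TTheory GRing.Theory Num.Theory.
Local Open Scope ring_scope.

(** Let sigma(z) be the sum of the s_i z^(-i-1), a rational function because the
    sequence is finite. One step of the Schur algorithm writes the Cauchy
    transform of s^(j-1), up to sign and to the precision of the data, as the
    image of that of s^(j) under the Moebius map of the factor M_j L_j. Hence, if
    W_2j has rows (A, B) and (C, E), the two remainders A + C sigma and
    B + E sigma have as quotient the Cauchy transform of s^(j), up to the same
    precision; moreover A + C sigma has order exactly n_j at infinity, so
    B + E sigma has order at least n_j + 1. Since E has degree at most n_j, it
    is orthogonal to 1, ..., z^(n_j - 1). As D_(n_j) is nonzero, E is
    proportional to P_(n_j), E(0) = 1 fixes the factor, and -B, the polynomial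
    part of E sigma, is the same multiple of Q_(n_j). This is the second column.

    The first column costs nothing more: E_j = l_j C_j + E_(j-1) and
    B_j = l_j A_j + B_(j-1) give A_j and C_j up to the factor 1/l_j, and l_j is
    found by comparing det W_2j = 1 with the Wronskian
    P_(n_j) Q_(n_(j-1)) - Q_(n_j) P_(n_(j-1)) = - b_0 ... b_(j-1), which comes
    from the three-term recurrence (wronskian, first_column).

    The algorithm must also be shown not to break down: s^(j) starts with
    exactly n_(j+1) - n_j - 1 zeros, and the shifted Hankel determinant in the
    denominator of l_(j+1) is nonzero. Both are read off the remainders. The
    first nonvanishing moment of E sits in position n_(j+1) - 1, because it
    always produces the next nonzero Hankel determinant of s (D_next,
    stage_next_order). If the shifted determinant vanished, then C - z m E would
    be orthogonal of degree at most n_(j+1) and vanish at 0; the determinant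
    D^+_(n_(j+1)) of s excludes that (stage_next_Dp).

    All congruences modulo powers of 1/z are statements about the order at
    infinity of elements of the field of fractions of R[z]. *)

Local Notation "x %:F" := (@FracField.tofrac _ x) (format "x %:F").

(** * Order at infinity of a rational function *)

(** The order is a predicate rather than a function, with an arbitrary fraction
    as witness, so that reduced fractions and the infinite order of 0 never have
    to be handled. *)
Definition ordinf (R : fieldType) (k : int) (f : {fraction {poly R}}) : Prop :=
  exists p q : {poly R},
    [/\ q != 0, f = p%:F / q%:F & (size p)%:Z + k <= (size q)%:Z].

Section OrdInf.
Variable R : fieldType.
Implicit Types (f g : {fraction {poly R}}) (p q : {poly R}) (k l : int).

Lemma ordinf0 k : ordinf k (0 : {fraction {poly R}}).
Proof.
exists 0, 'X^(`|k|%N); rewrite rmorph0 mul0r; split=> //.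
  by rewrite -size_poly_eq0 size_polyXn.
by rewrite size_poly0 size_polyXn; lia.
Qed.

Lemma ordinfW k l f : l <= k -> ordinf k f -> ordinf l f.
Proof. by move=> le_lk [p [q [nzq -> le_pq]]]; exists p, q; split=> //; lia. Qed.

Lemma ordinfN k f : ordinf k f -> ordinf k (- f).
Proof.
by case=> p [q [nzq -> le_pq]]; exists (- p), q; rewrite rmorphN mulNr size_polyN.
Qed.

Lemma ordinfD k f g : ordinf k f -> ordinf k g -> ordinf k (f + g).
Proof.
case=> p [q [nzq -> le_pq]] [p' [q' [nzq' -> le_pq']]].
exists (p * q' + p' * q), (q * q'); split; first by rewrite mulf_neq0.
  by rewrite rmorphD !rmorphM addf_div ?tofrac_eq0.
rewrite size_mul //.
have := size_polyD (p * q') (p' * q).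
have := size_polyMleq p q'; have := size_polyMleq p' q.
move: nzq nzq'; rewrite -!size_poly_gt0.
move: le_pq le_pq'.
move: (size (p * _ + _)) (size (p * _)) (size (p' * _)) => x y z.
move: (size p) (size q) (size p') (size q') => a b c d *. lia.
Qed.

Lemma ordinfB k f g : ordinf k f -> ordinf k g -> ordinf k (f - g).
Proof. by move=> Of Og; apply: ordinfD => //; apply: ordinfN. Qed.

Lemma ordinfM k l f g : ordinf k f -> ordinf l g -> ordinf (k + l) (f * g).
Proof.
case=> p [q [nzq -> le_pq]] [p' [q' [nzq' -> le_pq']]].
have [->|nzp] := eqVneq p 0; first by rewrite rmorph0 !mul0r; apply: ordinf0.
exists (p * p'), (q * q'); split; first by rewrite mulf_neq0.
  by rewrite !rmorphM mulf_div.
rewrite (size_mul nzq nzq'); have := size_polyMleq p p'.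
move: nzq nzq' nzp le_pq le_pq'; rewrite -!size_poly_gt0.
move: (size (p * _)) => x; move: (size p) (size q) (size p') (size q').
by move=> a b c d *; lia.
Qed.

Lemma ordinf_poly k p : ordinf k p%:F <-> p = 0 \/ (size p)%:Z + k <= 1.
Proof.
split=> [[p' [q [nzq pE le_pq]]] | [-> | le_p]]; last 2 first.
- by rewrite rmorph0; apply: ordinf0.
- by exists p, 1; rewrite rmorph1 divr1 oner_neq0 size_poly1.
have [->|nzp] := eqVneq p 0; [by left | right].
have pqE : p * q = p'.
  by apply/eqP; rewrite -tofrac_eq tofracM pE mulfVK ?tofrac_eq0.
move: le_pq nzp nzq; rewrite -pqE => le_pq nzp nzq; move: le_pq.
rewrite size_mul //; move: nzp nzq; rewrite -!size_poly_gt0.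
by move: (size p) (size q) => a b *; lia.
Qed.

Lemma ordinf_polyW (m : nat) p : (size p <= m.+1)%N -> ordinf (- m%:Z) p%:F.
Proof. by move=> le_p; apply/ordinf_poly; right; lia. Qed.

Lemma ordinf1_poly p : ordinf 1 p%:F -> p = 0.
Proof.
case/ordinf_poly=> // le_p; apply/eqP; rewrite -size_poly_eq0; lia.
Qed.

(** The polynomial part of a rational function at infinity is unique. *)
Lemma ordinf1_eq p q f : ordinf 1 (f - p%:F) -> ordinf 1 (f - q%:F) -> p = q.
Proof.
move=> Op Oq; apply/eqP; rewrite -subr_eq0; apply/eqP/ordinf1_poly.
rewrite tofracB.
have -> : p%:F - q%:F = (f - q%:F) - (f - p%:F) by ring.
exact: ordinfB.
Qed.

Lemma ordinf1_1 : ~ ordinf 1 (1 : {fraction {poly R}}).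
Proof.
by rewrite -(rmorph1 (@FracField.tofrac _)) => /ordinf1_poly/eqP; rewrite oner_eq0.
Qed.

(** Negating an order bound says that the order is at most k, which is exactly
    what bounds the inverse; nonvanishing at order k is always stated in this
    way below. *)
Lemma ordinfV k f : ~ ordinf (k + 1) f -> ordinf (- k) f^-1.
Proof.
have [p [q [nzq ->]]] : exists p q, q != 0 /\ f = p%:F / q%:F.
  elim/quotW: f => x; exists \n_x, \d_x; split; first exact: denom_ratioP.
  unlock FracField.tofrac; rewrite -[_ / _]/(FracField.mul _ (FracField.inv _)).
  rewrite -FracField.pi_inv -FracField.pi_mul /FracField.mulf /FracField.invf.
  have nzx := denom_ratioP x.
  by rewrite !numden_Ratio ?oner_neq0 // mulr1 mul1r Ratio_numden.
move=> nO; have nzp : p != 0.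
  by apply/eqP => p0; apply: nO; rewrite p0 rmorph0 mul0r; apply: ordinf0.
exists q, p; split=> //; first by rewrite invf_div.
by rewrite leNgt; apply/negP => lt_pq; apply: nO; exists p, q; split=> //; lia.
Qed.

End OrdInf.

(** * Expansions in powers of 1/z *)

Definition winf (R : fieldType) : {fraction {poly R}} := ('X%:F)^-1.

(** The value g(1/z), which turns a truncated power series in 1/z into a
    rational function. *)
Definition atinf (R : fieldType) (g : {poly R}) : {fraction {poly R}} :=
  (map_poly (@FracField.tofrac _ \o polyC) g).[winf R].

(** The sum of the s_i z^(-i-1). *)
Definition cauchy (R : fieldType) (s : seq R) : {fraction {poly R}} :=
  winf R * atinf (Poly s).

(** The functional S_t applied to p(t) t^k. *)
Definition moment (R : fieldType) (s : seq R) (p : {poly R}) (k : nat) : R :=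
  \sum_(i < size p) p`_i * s`_(i + k).

Section AtInf.
Variable R : fieldType.
Implicit Types (f : {fraction {poly R}}) (p q g h : {poly R}) (c : R).
Local Notation w := (winf R).

Lemma atinf0 : atinf (0 : {poly R}) = 0.
Proof. by rewrite /atinf rmorph0 horner0. Qed.

Lemma atinfD g h : atinf (g + h) = atinf g + atinf h.
Proof. by rewrite /atinf rmorphD hornerD. Qed.

Lemma atinfN g : atinf (- g) = - atinf g.
Proof. by rewrite /atinf rmorphN hornerN. Qed.

Lemma atinfM g h : atinf (g * h) = atinf g * atinf h.
Proof. by rewrite /atinf rmorphM hornerM. Qed.

Lemma atinfC c : atinf c%:P = c%:P%:F.
Proof. by rewrite /atinf map_polyC hornerC. Qed.

Lemma atinfX : atinf 'X = w.
Proof. by rewrite /atinf map_polyX hornerX. Qed.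

Lemma atinfXn n : atinf 'X^n = w ^+ n.
Proof. by rewrite /atinf map_polyXn hornerXn. Qed.

Lemma zeta_neq0 : ('X%:F : {fraction {poly R}}) != 0.
Proof. by rewrite tofrac_eq0 polyX_eq0. Qed.

Lemma zetaV : (('X : {poly R})%:F) * w = 1.
Proof. by rewrite mulfV // zeta_neq0. Qed.

Lemma ordinf_w : ordinf 1 w.
Proof.
exists 1, 'X; rewrite rmorph1 mul1r polyX_eq0; split=> //.
by rewrite size_poly1 size_polyX.
Qed.

Lemma ordinf_zeta : ordinf (- 1) (('X : {poly R})%:F).
Proof. by apply/ordinf_poly; right; rewrite size_polyX. Qed.

Lemma ordinf_const c : ordinf 0 (c%:P%:F).
Proof. by apply/ordinf_poly; right; rewrite size_polyC; case: (c != 0). Qed.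

Lemma ordinf0_atinf g : ordinf 0 (atinf g).
Proof.
elim/poly_ind: g => [|g c Og].
  by rewrite atinf0; apply: ordinf0.
rewrite atinfD atinfM atinfX atinfC; apply: ordinfD; last exact: ordinf_const.
by have := ordinfM Og ordinf_w; apply: ordinfW.
Qed.

(** By induction, dividing by 1/z once the constant term is known to vanish. *)
Lemma ordinf_atinf (k : nat) g :
  ordinf k%:Z (atinf g) <-> forall i, (i < k)%N -> g`_i = 0.
Proof.
elim: k g => [|k IHk] g; first by split=> // _; apply: ordinf0_atinf.
elim/poly_ind: g => [|g c _].
  split=> [_ i _|_]; first by rewrite coef0.
  by rewrite atinf0; apply: ordinf0.
have coefE i : (g * 'X + c%:P)`_i = if i is i'.+1 then g`_i' else c.
  by rewrite coefD coefMX coefC; case: i => [|i] /=; rewrite ?add0r ?addr0.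
have gE : atinf (g * 'X + c%:P) = atinf g * w + c%:P%:F.
  by rewrite atinfD atinfM atinfX atinfC.
split=> [Og | g0].
  have c0 : c = 0.
    apply/eqP; rewrite -polyC_eq0; apply/eqP/ordinf1_poly.
    have -> : c%:P%:F = atinf (g * 'X + c%:P) - atinf g * w by rewrite gE; ring.
    apply: ordinfB; first by apply: ordinfW Og; lia.
    by have := ordinfM (ordinf0_atinf g) ordinf_w; apply: ordinfW.
  move=> [|i] lt_ik; rewrite coefE // (IHk g).1 //.
  have -> : atinf g = 'X%:F * atinf (g * 'X + c%:P).
    by rewrite gE c0 rmorph0 addr0 mulrCA zetaV mulr1.
  by have := ordinfM ordinf_zeta Og; apply: ordinfW; lia.
have c0 : c = 0 by have := g0 0%N isT; rewrite coefE.
rewrite gE c0 rmorph0 addr0; have /IHk Og : forall i, (i < k)%N -> g`_i = 0.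
  by move=> i lt_ik; have := g0 i.+1 lt_ik; rewrite coefE.
by have := ordinfM Og ordinf_w; apply: ordinfW; lia.
Qed.

Lemma ordinf_cauchy (s : seq R) (k : nat) :
  ordinf k.+1%:Z (cauchy s) <-> forall i, (i < k)%N -> s`_i = 0.
Proof.
have -> : (forall i, (i < k)%N -> s`_i = 0) <->
          (forall i, (i < k)%N -> (Poly s)`_i = 0).
  by split=> s0 i /s0; rewrite coef_Poly.
rewrite -ordinf_atinf /cauchy; split=> Of.
  have -> : atinf (Poly s) = 'X%:F * (w * atinf (Poly s)).
    by rewrite mulrA zetaV mul1r.
  by have := ordinfM ordinf_zeta Of; apply: ordinfW; lia.
by have := ordinfM ordinf_w Of; apply: ordinfW; lia.
Qed.

Lemma atinf_rev (m : nat) p : (size p <= m)%N ->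
  atinf (Poly (rev (mkseq (fun i => p`_i) m))) * 'X%:F ^+ m = 'X%:F * p%:F.
Proof.
move=> le_pm; have pE : p = \sum_(i < m) (p`_i)%:P * 'X^i.
  rewrite -[LHS](@coefK R) (poly_def (size p)).
  rewrite (big_ord_widen m (fun i => p`_i *: 'X^i)) // big_mkcond.
  apply: eq_bigr => i _; rewrite mul_polyC; case: leqP => // le_pi.
  by rewrite nth_default ?scale0r.
have -> : Poly (rev (mkseq (fun i => p`_i) m)) =
          \sum_(i < m) (p`_i)%:P * 'X^(m.-1 - i).
  apply/polyP=> k; rewrite coef_Poly coef_sum.
  under eq_bigr do rewrite coefCM coefXn.
  case: (ltnP k m) => [lt_km | le_mk]; last first.
    rewrite nth_default ?size_rev ?size_mkseq // big1 // => i _.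
    by rewrite gtn_eqF ?mulr0 //; have := ltn_ord i; lia.
  rewrite nth_rev size_mkseq // nth_mkseq; last by lia.
  have lt_i : (m - k.+1 < m)%N by lia.
  rewrite (bigD1 (Ordinal lt_i)) //= big1 ?addr0 => [|i].
    by rewrite (_ : k == _) ?mulr1 //; apply/eqP; lia.
  rewrite -val_eqE /= => ne_i; case: eqP => [kE|]; last by rewrite mulr0.
  by case/eqP: ne_i; have := ltn_ord i; lia.
have sumE F : atinf (\sum_(i < m) F i) = \sum_(i < m) atinf (F i).
  by rewrite /atinf rmorph_sum horner_sum.
rewrite sumE mulr_suml [in RHS]pE rmorph_sum mulr_sumr; apply: eq_bigr => i _ /=.
rewrite atinfM atinfC atinfXn rmorphM rmorphXn mulrCA -mulrA; congr (_ * _).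
have Em : ((m.-1 - i) + i.+1)%N = m by have := ltn_ord i; lia.
rewrite -[in X in _ * X = _]Em exprD mulrA -exprMn [w * _]mulrC zetaV.
by rewrite expr1n mul1r exprS.
Qed.

End AtInf.

(** * Moment functional *)

Section Moment.
Variable R : fieldType.
Implicit Types (s : seq R) (p q : {poly R}) (c : R).
Local Notation w := (winf R).

Lemma moment_widen s p k m : (size p <= m)%N ->
  moment s p k = \sum_(i < m) p`_i * s`_(i + k).
Proof.
move=> le_pm; rewrite /moment.
rewrite (big_ord_widen m (fun i => p`_i * s`_(i + k))) // big_mkcond.
apply: eq_bigr => i _; case: leqP => // le_pi.
by rewrite nth_default ?mul0r.
Qed.

Lemma momentMXaddC s q c k :
  moment s (q * 'X + c%:P) k = moment s q k.+1 + c * s`_k.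
Proof.
rewrite (@moment_widen _ _ _ (size q).+1); last first.
  rewrite (leq_trans (size_polyD _ _)) // geq_max size_polyC.
  rewrite (leq_trans (size_polyMleq _ _)) ?size_polyX ?addn2 //=.
  by case: (c != 0).
rewrite big_ord_recl addrC; congr (_ + _).
  apply: eq_bigr => i _; rewrite lift0 coefD coefMX coefC /= addr0.
  by rewrite addnS addSn.
by rewrite coefD coefMX coefC /= add0r.
Qed.

Lemma moment_lin s c p q k :
  moment s (c *: p + q) k = c * moment s p k + moment s q k.
Proof.
pose m := maxn (size (c *: p + q)) (maxn (size p) (size q)).
rewrite !(@moment_widen _ _ _ m) ?leq_max ?leqnn ?orbT //.
rewrite mulr_sumr -big_split. apply: eq_bigr => i _ /=.
by rewrite coefD coefZ mulrDl mulrA.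
Qed.

(** Both sides are S_t applied to p(t) q(t) t^k. *)
Lemma moment_sym s p q k :
  \sum_(l < size q) q`_l * moment s p (l + k) =
  \sum_(i < size p) p`_i * moment s q (i + k).
Proof.
under eq_bigr do rewrite mulr_sumr.
rewrite exchange_big; apply: eq_bigr => i _; rewrite mulr_sumr.
by apply: eq_bigr => l _; rewrite mulrCA addnCA.
Qed.

Lemma moment_default s p k : (size s <= k)%N -> moment s p k = 0.
Proof.
move=> le_sk; apply: big1 => i _; rewrite [s`__]nth_default ?mulr0 //.
by rewrite (leq_trans le_sk) ?leq_addl.
Qed.

Lemma moment1 s k : moment s 1 k = s`_k.
Proof. by rewrite /moment size_poly1 big_ord1 coef1 mul1r. Qed.

Lemma Sfun_widen s (a : {poly {poly R}}) m : (size a <= m)%N ->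
  Sfun s a = \sum_(i < m) s`_i *: a`_i.
Proof.
move=> le_am; rewrite /Sfun (big_ord_widen m (fun i => s`_i *: a`_i)) //.
rewrite big_mkcond; apply: eq_bigr => i _; case: leqP => // le_ai.
by rewrite [a`__]nth_default ?scaler0.
Qed.

Lemma SfunD s (a b : {poly {poly R}}) : Sfun s (a + b) = Sfun s a + Sfun s b.
Proof.
pose m := maxn (size (a + b)) (maxn (size a) (size b)).
rewrite !(@Sfun_widen _ _ m) ?leq_max ?leqnn ?orbT // -big_split.
by apply: eq_bigr => i _ /=; rewrite coefD scalerDr.
Qed.

Lemma SfunCM s p (a : {poly {poly R}}) : Sfun s (p%:P * a) = p * Sfun s a.
Proof.
pose m := maxn (size (p%:P * a)) (size a).
rewrite !(@Sfun_widen _ _ m) ?leq_max ?leqnn ?orbT // mulr_sumr.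
by apply: eq_bigr => i _ /=; rewrite coefCM scalerAr.
Qed.

Lemma Sfun_map s p : Sfun s (map_poly polyC p) = (moment s p 0)%:P.
Proof.
rewrite (@Sfun_widen _ _ (size p)) ?size_poly // rmorph_sum.
by apply: eq_bigr => i _; rewrite coef_map addn0 /= -mul_polyC -polyCM mulrC.
Qed.

Lemma ddiffMXaddC p c :
  ddiff (p * 'X + c%:P) = 'X%:P * ddiff p + map_poly polyC p.
Proof.
have nzX : 'X%:P - 'X != 0 :> {poly {poly R}}.
  by rewrite -opprB oppr_eq0 polyXsubC_eq0.
apply: (mulIf nzX); rewrite mulrDl -mulrA !ddiffE.
rewrite !rmorphD !rmorphM /= map_polyX map_polyC; ring.
Qed.

Lemma ddiff0 : ddiff (0 : {poly R}) = 0.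
Proof. by rewrite /ddiff !rmorph0 subrr div0p. Qed.

(** For p = z^m this only separates the terms s_i z^(m-i-1) with i < m from the
    others; the induction on p avoids computing the divided difference of a
    monomial. *)
Lemma cauchyE s p (M : nat) : (size s <= M)%N ->
  p%:F * cauchy s =
    (Sfun s (ddiff p))%:F + w * atinf (\poly_(k < M) moment s p k).
Proof.
move=> le_sM; elim/poly_ind: p => [|p c IHp].
  rewrite ddiff0 /Sfun size_poly0 big_ord0 rmorph0 mul0r.
  rewrite (_ : \poly_(k < M) _ = 0); first by rewrite atinf0; ring.
  by apply/polyP=> k; rewrite coef_poly /moment size_poly0 big_ord0 coef0 if_same.
have -> : \poly_(k < M) moment s (p * 'X + c%:P) k =
    \poly_(k < M) moment s p k.+1 + c%:P * Poly s.
  apply/polyP=> k; rewrite coefD coefCM coef_Poly !coef_poly momentMXaddC.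
  case: ltnP => // le_Mk.
  by rewrite [s`_k]nth_default ?mulr0 ?addr0 // (leq_trans le_sM).
have EM : \poly_(k < M) moment s p k =
    \poly_(k < M) moment s p k.+1 * 'X + (moment s p 0)%:P.
  apply/polyP=> k; rewrite coefD coefMX coefC !coef_poly.
  case: k => [|k] /=; rewrite ?add0r ?addr0.
    by case: posnP => // M0; rewrite moment_default ?(leq_trans le_sM) ?M0.
  case: ltnP => [lt_kM|le_Mk]; first by rewrite ltnW.
  by case: ltnP => // _; rewrite moment_default // (leq_trans le_sM).
rewrite ddiffMXaddC SfunD SfunCM Sfun_map !atinfD !atinfM !atinfC.
rewrite rmorphD rmorphM /= mulrDl mulrAC IHp EM atinfD atinfM atinfX atinfC.
have := @zetaV R; rewrite /cauchy tofracD tofracM.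
move: ('X%:F) w (Sfun _ _)%:F (atinf (\poly_(_ < _) _)) => z v S a.
move: (atinf (Poly s)) (c%:P%:F) (_%:P%:F) => b x y zv1.
have -> : (S + v * (a * v + y)) * z = S * z + (z * v) * (a * v + y) by ring.
by rewrite zv1; ring.
Qed.

(** The bridge between approximation and orthogonality: an approximation of
    order k + 1 of p sigma by a polynomial is possible only with the polynomial
    of the second kind of p, and then says that p is orthogonal to z^i for
    i < k. *)
Lemma ordinf_moment s p q (k : nat) :
  ordinf k.+1%:Z (p%:F * cauchy s - q%:F) <->
  q = Sfun s (ddiff p) /\ forall i, (i < k)%N -> moment s p i = 0.
Proof.
pose M := maxn (size s) k.
have le_sM : (size s <= M)%N by rewrite leq_maxl.
have sE := cauchyE p le_sM.
have Ow g : ordinf 1 (w * atinf g).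
  by have := ordinfM (@ordinf_w R) (ordinf0_atinf g); apply: ordinfW.
have coefM i : (i < k)%N -> (\poly_(i < M) moment s p i)`_i = moment s p i.
  by move=> lt_ik; rewrite coef_poly leq_max lt_ik orbT.
split=> [Op | [-> mom0]].
  have qE : q = Sfun s (ddiff p).
    apply: (@ordinf1_eq _ _ _ (p%:F * cauchy s)); first by apply: ordinfW Op; lia.
    by rewrite sE addrAC subrr add0r.
  split=> // i lt_ik; rewrite -coefM //.
  apply: (ordinf_atinf k _).1 lt_ik.
  have -> : atinf (\poly_(k < M) moment s p k) = 'X%:F * (p%:F * cauchy s - q%:F).
    by rewrite sE qE addrAC subrr add0r mulrA zetaV mul1r.
  by have := ordinfM (@ordinf_zeta R) Op; apply: ordinfW; lia.
rewrite sE addrAC subrr add0r.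
have /ordinf_atinf Oa : forall i, (i < k)%N -> (\poly_(i < M) moment s p i)`_i = 0.
  by move=> i lt_ik; rewrite coefM // mom0.
by have := ordinfM (@ordinf_w R) Oa; apply: ordinfW; lia.
Qed.

End Moment.

(** * Hankel determinants and orthogonality *)

Section HankelKernel.
Variable R : fieldType.
Implicit Types (s : seq R) (p q : {poly R}).

(** The coefficients of p form a vector in the kernel of the Hankel matrix. *)
Lemma D_ker s m p : D s m != 0 -> (size p <= m)%N ->
  (forall k, (k < m)%N -> moment s p k = 0) -> p = 0.
Proof.
move=> nzD le_pm mom0; pose v : 'rV[R]_m := \row_i p`_i.
have : v *m hankel s m = 0.
  apply/rowP=> j; rewrite !mxE -[RHS](mom0 j) // (moment_widen _ _ le_pm).
  by apply: eq_bigr => i _; rewrite !mxE.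
move=> /(congr1 (mulmxr (invmx (hankel s m)))) /=.
rewrite mul0mx mulmxK ?unitmxE ?unitfE // => v0.
apply/polyP=> i; rewrite coef0; have [lt_im|le_mi] := ltnP i m.
  by have /rowP/(_ (Ordinal lt_im)) := v0; rewrite !mxE.
by rewrite nth_default // (leq_trans le_pm).
Qed.

Lemma D_neq0 s m :
  (forall p, (size p <= m)%N ->
     (forall k, (k < m)%N -> moment s p k = 0) -> p = 0) -> D s m != 0.
Proof.
move=> ker0; apply/negP => /det0P[v nzv v0]; case/eqP: nzv.
pose p : {poly R} := \poly_(i < m) (if insub i is Some j then v ord0 j else 0).
have pE (i : 'I_m) : p`_i = v ord0 i by rewrite coef_poly ltn_ord valK.
have p0 : p = 0.
  apply: ker0 => [|k lt_km]; first exact: size_poly.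
  have /rowP/(_ (Ordinal lt_km)) := v0; rewrite !mxE => <-.
  rewrite (moment_widen _ _ (size_poly _ _)).
  by apply: eq_bigr => i _; rewrite pE !mxE.
by apply/rowP=> i; rewrite mxE -pE p0 coef0.
Qed.

Lemma Dp_behead s m : Dp s m = D (behead s) m.
Proof.
by congr (\det _); apply/matrixP=> i j; rewrite !mxE nth_behead addn1.
Qed.

Lemma moment_behead s p k : moment (behead s) p k = moment s (p * 'X) k.
Proof.
have := momentMXaddC s p 0 k; rewrite addr0 mul0r addr0 => ->.
by apply: eq_bigr => i _; rewrite nth_behead addnS.
Qed.

Lemma D_eq0 s m p : p != 0 -> (size p <= m)%N ->
  (forall k, (k < m)%N -> moment s p k = 0) -> D s m = 0.
Proof.
by move=> nzp le_pm mom0; apply: contra_neq_eq nzp => nzD; apply: D_ker mom0.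
Qed.

(** If q of degree at most r is in the kernel, pair q with p, p z, p z^2, ...:
    the only surviving term is the leading coefficient of q times the moment
    of order r of p, so the degree of q drops one step at a time until it is
    below m, where D s m decides. *)
Lemma D_next s m r p : D s m != 0 -> (size p <= m.+1)%N -> (m <= r)%N ->
  (forall k, (k < r)%N -> moment s p k = 0) -> moment s p r != 0 ->
  D s r.+1 != 0.
Proof.
move=> nzD le_pm le_mr momp nzmom; apply: D_neq0 => q le_qr momq.
(* At step e, the factor z^e moves the leading term of q to index r. *)
have down e : (e <= r.+1 - m)%N -> (size q <= r.+1 - e)%N.
  elim: e => [|e IHe] le_e; first by rewrite subn0.
  have {IHe} := IHe (ltnW le_e); set t := (r - e)%N.
  have -> : (r.+1 - e = t.+1)%N by rewrite /t; lia.
  have -> : (r.+1 - e.+1 = t)%N by rewrite /t; lia.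
  move=> le_qt; apply/leq_sizeP => i; rewrite leq_eqVlt => /orP[/eqP <-|]; last first.
    by move=> lt_ti; rewrite nth_default // (leq_trans le_qt).
  have := moment_sym s p q e.
  rewrite [RHS]big1 => [|j _]; last first.
    rewrite momq ?mulr0 //; have := ltn_ord j; rewrite /t in le_qt *; lia.
  rewrite (big_ord_widen t.+1 (fun l => q`_l * moment s p (l + e))) //.
  rewrite big_mkcond big_ord_recr big1 => [|j _] /=; last first.
    by case: ifP => // _; rewrite momp ?mulr0 //; have := ltn_ord j; rewrite /t; lia.
  have -> : (t + e = r)%N by rewrite /t; lia.
  rewrite add0r; case: ltnP => [_ /eqP|le_qt' _]; last by rewrite nth_default.
  by rewrite mulf_eq0 (negPf nzmom) orbF => /eqP.
apply: (D_ker nzD) => [|k lt_km]; last by apply: momq; lia.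
by have := down _ (leqnn _); rewrite subKn // ltnW.
Qed.

Lemma D_leading_zeros s v : (forall i, (i < v)%N -> s`_i = 0) -> s`_v != 0 ->
  D s v.+1 != 0.
Proof.
move=> s0 nzs; apply: (@D_next s 0 v 1) => //.
- by rewrite /D det_mx00 oner_neq0.
- by rewrite size_poly1.
- by move=> k lt_kv; rewrite moment1 s0.
- by rewrite moment1.
Qed.

(** * The polynomials of the Schur algorithm *)

Lemma schur_Delta_cofactor s v : schur_Delta s v.+1 =
  \sum_(p < v.+1) (cofactor (hankel (behead s) v.+1) ord_max p)%:P * 'X^p.
Proof.
rewrite /schur_Delta (expand_det_row _ ord_max); apply: eq_bigr => p _.
rewrite mxE /= subn1 ltnn mulrC; congr (_ * _).
rewrite -cofactor_map_mx; congr (_ * \det _).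
apply/matrixP=> a c; rewrite !mxE !lift_max /= ltn_ord.
by rewrite nth_behead addn1.
Qed.

Lemma size_schur_Delta s v : (size (schur_Delta s v.+1) <= v.+1)%N.
Proof.
rewrite schur_Delta_cofactor (leq_trans (size_sum _ _ _)) //.
apply/bigmax_leqP => p _; rewrite mul_polyC.
by rewrite (leq_trans (size_scale_leq _ _)) // size_polyXn.
Qed.

Lemma lead_schur_Delta s v : (schur_Delta s v.+1)`_v = D (behead s) v.
Proof.
rewrite schur_Delta_cofactor coef_sum big_ord_recr /= big1 => [|p _]; last first.
  by rewrite coefCM coefXn gtn_eqF ?mulr0 //=.
rewrite add0r coefCM coefXn eqxx mulr1 /cofactor /= -signr_odd oddD addbb mul1r.
by congr (\det _); apply/matrixP=> a c; rewrite !mxE !lift_max.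
Qed.

(** Prepending one entry undoes the index shift in the rows of schur_Delta, so
    that what is known about that determinant applies to the orthogonal
    polynomials. *)
Lemma Ppol_Delta s m : Ppol s m = (D s m)^-1 *: schur_Delta (0 :: s) m.+1.
Proof.
congr (_ *: \det _); apply/matrixP=> i j; rewrite !mxE subn1 /=.
by rewrite addn1.
Qed.

Lemma size_Ppol s m : (size (Ppol s m) <= m.+1)%N.
Proof.
by rewrite Ppol_Delta (leq_trans (size_scale_leq _ _)) ?size_schur_Delta.
Qed.

Lemma lead_Ppol s m : D s m != 0 -> (Ppol s m)`_m = 1.
Proof. by move=> nzD; rewrite Ppol_Delta coefZ lead_schur_Delta mulVf. Qed.

(** The moment is a determinant with two equal rows. *)
Lemma moment_Ppol s m k : (k < m)%N -> moment s (Ppol s m) k = 0.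
Proof.
move=> lt_km; rewrite (moment_widen _ _ (size_Ppol s m)) Ppol_Delta.
under eq_bigr do rewrite coefZ -mulrA.
rewrite -mulr_sumr.
under eq_bigr do rewrite addnC -[s`__]/((0 :: s)`_(k.+1 + _)).
rewrite schur_DeltaE (determinant_alternate (i1 := inord k) (i2 := ord_max)).
- by rewrite mulr0.
- by rewrite -val_eqE /= inordK ?ltn_eqF // ltnW.
by move=> c; rewrite !mxE /= inordK ?ltnn ?lt_km ?addn1 // ltnW.
Qed.

Lemma orthogonal_Ppol s m p : D s m != 0 -> (size p <= m.+1)%N ->
  (forall k, (k < m)%N -> moment s p k = 0) -> p = p`_m *: Ppol s m.
Proof.
move=> nzD le_pm mom0; apply/eqP; rewrite -subr_eq0 addrC -scaleNr; apply/eqP.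
apply: (D_ker nzD) => [|k lt_km]; last first.
  by rewrite moment_lin mom0 // moment_Ppol // mulr0 addr0.
apply/leq_sizeP => i le_mi; rewrite coefD coefZ.
have [<-|ne_im] := eqVneq m i; first by rewrite lead_Ppol // mulr1 addNr.
have lt_mi : (m < i)%N by rewrite ltn_neqAle ne_im.
rewrite [p`_i]nth_default ?(leq_trans le_pm) // addr0.
by rewrite [_`_i]nth_default ?mulr0 // (leq_trans (size_Ppol _ _)).
Qed.

Lemma size_schur_m s v : (size (schur_m s v.+1) <= v.+1)%N.
Proof. by rewrite (leq_trans (size_scale_leq _ _)) ?size_schur_Delta. Qed.

Lemma moment_schur_m s v i :
  (forall a, (a < v)%N -> s`_a = 0) -> D s v.+1 != 0 -> (i <= v)%N ->
  moment s (schur_m s v.+1) i = (i == 0)%:R.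
Proof.
move=> s0 nzD le_iv; rewrite -(schur_mE s0 nzD le_iv).
rewrite (moment_widen _ _ (size_schur_m s v)).
by apply: eq_bigr => p _; rewrite addnC.
Qed.

(** In the setting of moment_schur_m, z m(z) times the Cauchy transform is 1 up
    to order v + 1, and this is its coefficient at z^(-v-1): it vanishes exactly
    when the shifted Hankel determinant does. *)
Lemma moment_schur_m_last s v :
  moment s (schur_m s v.+1) v.+1 = (-1) ^+ (v.+1 + 1) / D s v.+1 * Dp s v.+1.
Proof.
rewrite (moment_widen _ _ (size_schur_m s v)).
under eq_bigr do rewrite addnC coefZ -mulrA.
rewrite -mulr_sumr schur_DeltaE; congr (_ * \det _).
apply/matrixP=> a c; rewrite !mxE addn1 [in RHS]addn1.
by case: ltnP => // le_va; have -> : (a = v :> nat) by have := ltn_ord a; lia.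
Qed.

End HankelKernel.

(** * One step of the Schur algorithm *)

Section SchurStep.
Variable R : fieldType.
Implicit Types (s t fs : seq R) (p q A B C E : {poly R}).
Implicit Types (f : {fraction {poly R}}).
Local Notation w := (winf R).
Local Notation z := (('X : {poly R})%:F).

(** Multiplying upper triangular Toeplitz matrices is multiplying truncated
    power series. *)
Lemma toeplitz_atinf k s t : toeplitz k.+1 s *m toeplitz k.+1 t = 1%:M ->
  ordinf k.+1%:Z (atinf (Poly s) * atinf (Poly t) - 1).
Proof.
move/toeplitz_mul1P => st1.
have -> : atinf (Poly s) * atinf (Poly t) - 1 = atinf (Poly s * Poly t - 1).
  by rewrite atinfD atinfN atinfM -[X in _ = _ - atinf X]polyC1 atinfC rmorph1.
apply/ordinf_atinf => i le_ik; rewrite coefB coefM coef1 -st1 //.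
by under eq_bigr do rewrite !coef_Poly; rewrite subrr.
Qed.

Lemma Poly_cat s t : Poly (s ++ t) = Poly s + 'X^(size s) * Poly t.
Proof.
apply/polyP=> i; rewrite coefD coefXnM !coef_Poly nth_cat.
by case: ltnP => [|le_si]; rewrite ?addr0 // [in RHS]nth_default ?add0r.
Qed.

Lemma Poly_opp s : Poly [seq - x | x <- s] = - Poly s.
Proof.
apply/polyP=> i; rewrite coefN !coef_Poly; case: (ltnP i (size s)) => lt_i.
  by rewrite (nth_map 0).
by rewrite !nth_default ?size_map ?oppr0.
Qed.

Lemma cauchy_drop s v : (forall i, (i < v)%N -> s`_i = 0) ->
  cauchy s = w ^+ v.+1 * atinf (Poly (drop v s)).
Proof.
move=> s0; rewrite /cauchy exprS -mulrA; congr (_ * _).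
rewrite -atinfXn -atinfM; congr atinf; apply/polyP=> i.
rewrite coefXnM !coef_Poly; case: ltnP => [/s0 //|le_vi].
by rewrite nth_drop subnKC.
Qed.

(** Here f agrees with the Cauchy transform of s as far as s determines it.
    With g the series of fs in 1/z, the first Toeplitz equation says that
    u = g up to terms beyond the available precision, and the second one that
    1/u is l minus the Cauchy transform of t. Each inversion is legitimate
    because the orders of f and u are exactly known. *)
Lemma schur_step_expansion s t fs v f : (2 * v.+1 <= size s)%N ->
  (forall i, (i < v)%N -> s`_i = 0) -> s`_v != 0 ->
  schur_step s v.+1 fs t ->
  ordinf (size s).+1%:Z (f - cauchy s) ->
  let u := z * (schur_m s v.+1)%:F - f^-1 in
  [/\ ordinf 0 u, ~ ordinf 1 u
    & ordinf (size t).+1%:Z ((schur_l s v.+1)%:P%:F - u^-1 - cauchy t)].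
Proof.
move=> le_vs s0 nzs [_ sz_t T1 T2] Of u.
set m := schur_m s v.+1 in u T1 *; set l := schur_l s v.+1 in T2 *.
set L := (size s - 2 * v.+1)%N in T2 sz_t.
have sz_s : size s = (L + 2 * v.+1)%N by rewrite /L; lia.
have Oc : ordinf v.+1%:Z (cauchy s) by apply/ordinf_cauchy.
have nOf : ~ ordinf (v.+1%:Z + 1) f.
  move=> Of'; case/eqP: nzs; apply: (ordinf_cauchy s v.+1).1 (ltnSn v).
  have -> : cauchy s = f - (f - cauchy s) by ring.
  by apply: ordinfB; [apply: ordinfW Of' | apply: ordinfW Of]; lia.
have Vf := ordinfV nOf.
have nzf : f != 0 by apply/eqP => f0; apply: nOf; rewrite f0; apply: ordinf0.
have {T1} := toeplitz_atinf T1; have {T2} := toeplitz_atinf T2.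
rewrite Poly_cat size_rev size_mkseq Poly_opp subn1 /=.
rewrite cons_poly_def Poly_opp mulNr.
rewrite !(atinfD, atinfM, atinfN, atinfC, atinfX, atinfXn).
have := atinf_rev (size_schur_m s v); rewrite -/m.
have := cauchy_drop s0; rewrite [cauchy t]/cauchy.
have := ordinf0_atinf (Poly fs); have := ordinf0_atinf (Poly t).
move: (atinf (Poly fs)) (atinf (Poly t)) (atinf (Poly (drop v s))) => g b a.
move: (atinf (Poly _)) => r Ob Og cE rE T2 T1.
have zw1 : z ^+ v.+1 * w ^+ v.+1 = 1 by rewrite -exprMn zetaV expr1n.
have Ozm : ordinf (- v.+1%:Z) (z * m%:F).
  have := ordinfM (@ordinf_zeta R) (ordinf_polyW (size_schur_m s v)).
  by apply: ordinfW; lia.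
have Ozmg : ordinf (- v.+1%:Z) (z * m%:F - g).
  by apply: ordinfB => //; apply: ordinfW Og; lia.
have T1' : ordinf (L + v.+1).+1%:Z (cauchy s * (z * m%:F - g) - 1).
  have -> : (L + v.+1).+1 = (size s - v.+1).+1 by rewrite sz_s; lia.
  have -> : cauchy s * (z * m%:F - g) - 1 =
    (z ^+ v.+1 * w ^+ v.+1) * r * a - w ^+ v.+1 * g * a - 1.
    by rewrite cE -rE; ring.
  by rewrite zw1 mul1r -mulrBl -mulrN.
have Oug : ordinf (L.+1%:Z) (u - g).
  have -> : u - g = f^-1 * ((f - cauchy s) * (z * m%:F - g) +
                            (cauchy s * (z * m%:F - g) - 1)).
    rewrite /u; set x := z * _.
    by transitivity (f^-1 * f * (x - g) - f^-1); [rewrite mulVf // mul1r; ring | ring].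
  have Oh := ordinfM Of Ozmg.
  have := ordinfM Vf (ordinfD (ordinfW _ Oh) (ordinfW _ T1')).
  move=> /(_ (L + v.+1).+1%:Z); rewrite sz_s => Ox.
  by apply: (ordinfW _ (Ox _ _)); lia.
have Ol : ordinf 0 (l%:P%:F - w * b).
  apply: ordinfB; first exact: ordinf_const.
  by have := ordinfM (@ordinf_w R) Ob; apply: ordinfW.
have Ou : ordinf 0 u.
  have -> : u = (u - g) + g by ring.
  by apply: ordinfD => //; apply: ordinfW Oug; lia.
have T2' : ordinf L.+1%:Z ((l%:P%:F - w * b) * g - 1).
  by rewrite [X in X * g]addrC [w * b]mulrC.
have nOu : ~ ordinf 1 u.
  move=> Ou1; apply: (@ordinf1_1 R).
  have -> : 1 = (l%:P%:F - w * b) * (u - (u - g)) - ((l%:P%:F - w * b) * g - 1) by ring.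
  apply: ordinfB; last by apply: ordinfW T2'; lia.
  by have := ordinfM Ol (ordinfB Ou1 (ordinfW _ Oug)); rewrite add0r; apply; lia.
split=> //.
have nzu : u != 0 by apply/eqP => u0; apply: nOu; rewrite u0; apply: ordinf0.
have -> : l%:P%:F - u^-1 - w * b =
    u^-1 * ((l%:P%:F - w * b) * (u - g) + ((l%:P%:F - w * b) * g - 1)).
  move: (l%:P%:F) (w * b) => x y.
  by transitivity (u^-1 * u * (x - y) - u^-1); [rewrite mulVf // mul1r; ring | ring].
have Vu : ordinf 0 u^-1 by have := @ordinfV _ 0 u; rewrite add0r oppr0; apply.
have := ordinfM Ol Oug; rewrite add0r => Olu.
by rewrite sz_t -[L.+1%:Z]add0r; apply: ordinfM Vu (ordinfD Olu T2').
Qed.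

End SchurStep.

(** * Partial products of the Schur algorithm as Pade approximants *)

Lemma quotient_step (F : fieldType) (x y u : F) : x != 0 -> u != 0 ->
  (y * - (x * u) + x) / - (x * u) = y - u^-1.
Proof.
move=> nzx nzu; rewrite mulrDl mulfK ?oppr_eq0 ?mulf_neq0 //.
by rewrite invrN invfM mulrN mulrA mulfV // mul1r.
Qed.

Section Stage.
Variable R : fieldType.
Implicit Types (s t : seq R) (A B C E : {poly R}).
Local Notation w := (winf R).
Local Notation z := (('X : {poly R})%:F).

(** For a column (A, C) of W_2j: C times the error made by approximating sigma
    by - A / C. *)
Definition remainder s A C : {fraction {poly R}} := A%:F + C%:F * cauchy s.

(** What is preserved along the algorithm by W = (A B; C E), when the Hankel
    size k has been reached and t is the current sequence. The orders of the two
    remainders are the source of orthogonality; [stage_exact] is needed to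
    divide by the first one, and [stage_tail] is the congruence modulo
    precision that says which Cauchy transform their quotient is. *)
Record stage s k t A B C E : Prop := Stage {
  stage_size_E : (size E <= k.+1)%N;
  stage_size_C : (size C <= k.+1)%N;
  stage_E0 : E`_0 = 1;
  stage_C0 : C`_0 = 0;
  stage_det : A * E - B * C = 1;
  stage_ord : ordinf k%:Z (remainder s A C);
  stage_exact : ~ ordinf (k%:Z + 1) (remainder s A C);
  stage_tail :
    ordinf (size t).+1%:Z (remainder s B E / remainder s A C - cauchy t)
}.

Lemma stage_init s : stage s 0 s 1 0 0 1.
Proof.
have r1 : remainder s 1 0 = 1 by rewrite /remainder rmorph1 rmorph0 mul0r addr0.
split; rewrite ?size_poly1 ?size_poly0 ?coef1 ?coef0 ?mulr1 ?mulr0 ?subr0 ?r1 //.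
- by rewrite -(rmorph1 (@FracField.tofrac _)); apply: ordinf_const.
- exact: ordinf1_1.
by rewrite /remainder rmorph0 rmorph1 divr1 mul1r add0r subrr; apply: ordinf0.
Qed.

Section Consequences.
Variables (s : seq R) (k : nat) (t : seq R) (A B C E : {poly R}).
Hypothesis st : stage s k t A B C E.

Lemma stage_rest_neq0 : remainder s A C != 0.
Proof. by apply/eqP => r0; apply: (stage_exact st); rewrite r0; apply: ordinf0. Qed.

Lemma stage_orthogonal :
  - B = Sfun s (ddiff E) /\ forall i, (i < k)%N -> moment s E i = 0.
Proof.
apply/ordinf_moment; rewrite tofracN opprK addrC.
rewrite -[X in ordinf _ X]/(remainder s B E).
rewrite -[remainder s B E](divfK stage_rest_neq0).
have Ophi : ordinf 1 (remainder s B E / remainder s A C).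
  rewrite -[_ / _](subrK (cauchy t)); apply: ordinfD.
    by apply: ordinfW (stage_tail st); lia.
  exact: (ordinf_cauchy t 0).2.
by have := ordinfM Ophi (stage_ord st); apply: ordinfW; lia.
Qed.

Lemma stage_Ppol : D s k != 0 ->
  [/\ (Ppol s k).[0] != 0, E = ((Ppol s k).[0])^-1 *: Ppol s k
    & B = - (((Ppol s k).[0])^-1 *: Qpol s k)].
Proof.
move=> nzD; have [BE momE] := stage_orthogonal.
have EP := orthogonal_Ppol nzD (stage_size_E st) momE.
have eP1 : E`_k * (Ppol s k).[0] = 1.
  by rewrite -(stage_E0 st) [in RHS]EP coefZ horner_coef0.
have nzP : (Ppol s k).[0] != 0.
  by apply: contra_eq_neq eP1 => ->; rewrite mulr0 eq_sym oner_neq0.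
have ekE : E`_k = ((Ppol s k).[0])^-1 by rewrite -[LHS](mulfK nzP) eP1 mul1r.
rewrite ekE in EP; split=> //; apply: oppr_inj; rewrite opprK.
have OE : ordinf 1 (E%:F * cauchy s - (- B)%:F).
  by apply/(ordinf_moment _ _ _ 0).
apply: (ordinf1_eq OE).
rewrite [in X in X * _]EP -!mul_polyC !tofracM -mulrA -mulrBr.
have OP : ordinf 1 ((Ppol s k)%:F * cauchy s - (Qpol s k)%:F).
  by apply/(ordinf_moment _ _ _ 0).
by rewrite -[1]add0r; apply: ordinfM OP; apply: ordinf_const.
Qed.

Variable v : nat.
Hypothesis nzD : D s k != 0.
Hypothesis nzD' : D s (k + v.+1) != 0.
Hypothesis gap : forall m, (k < m)%N -> (m < k + v.+1)%N -> D s m = 0.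
Hypothesis sz_t : (2 * v.+1 <= size t)%N.

(** The order of the second remainder is one more than the index r of the first
    nonvanishing moment of E. E is a kernel vector of every Hankel matrix of
    size m with k < m <= r, and by D_next the matrix of size r + 1 is
    invertible, so r + 1 must be the next normal index. *)
Lemma stage_next_order :
  ordinf (k + v.+1)%:Z (remainder s B E) /\
  ~ ordinf ((k + v.+1)%:Z + 1) (remainder s B E).
Proof.
have [BE momE] := stage_orthogonal.
have nzE : E != 0.
  apply/eqP => E0; have := stage_E0 st; rewrite E0 coef0 => /esym/eqP.
  by rewrite oner_eq0.
have restE : remainder s B E = E%:F * cauchy s - (- B)%:F.
  by rewrite tofracN opprK addrC.
have /existsP[i0 nz0] : [exists i : 'I_(k + v.+1), moment s E i != 0].
  apply: contraNT nzD' => /existsPn mom0; apply/eqP.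
  apply: (D_eq0 nzE) => [|i lt_i]; last exact/eqP/negPn/(mom0 (Ordinal lt_i)).
  by rewrite (leq_trans (stage_size_E st)) // -[k.+1]addn1 leq_add2l.
have exE : exists i, moment s E i != 0 by exists i0.
case: (ex_minnP exE) => r nzr min_r.
have momr i : (i < r)%N -> moment s E i = 0.
  by move=> lt_ir; apply/eqP/negPn; apply/negP => /min_r; rewrite leqNgt lt_ir.
have le_kr : (k <= r)%N by rewrite leqNgt; apply: contra nzr => /momE->.
have lt_r : (r < k + v.+1)%N by rewrite (leq_ltn_trans (min_r _ nz0)).
have nzDr := D_next nzD (stage_size_E st) le_kr momr nzr.
have rE : (k + v.+1)%N = r.+1.
  apply/eqP; rewrite eqn_leq lt_r andbT leqNgt; apply: contra nzDr => lt_r'.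
  by rewrite gap.
rewrite restE rE; split; first exact/ordinf_moment.
have -> : r.+1%:Z + 1 = r.+2%:Z by lia.
by case/ordinf_moment=> _ /(_ r (ltnSn r))/eqP; rewrite (negPf nzr).
Qed.

(** The quotient of the remainders has order exactly v + 1, and the precision is
    large enough to pass this on to t itself. *)
Lemma stage_next_tail : (forall i, (i < v)%N -> t`_i = 0) /\ t`_v != 0.
Proof.
have [O nO] := stage_next_order; have nzA := stage_rest_neq0.
have VA := ordinfV (stage_exact st).
have tE : cauchy t = remainder s B E / remainder s A C -
                     (remainder s B E / remainder s A C - cauchy t) by ring.
have t0 : forall i, (i < v)%N -> t`_i = 0.
  apply/ordinf_cauchy; rewrite tE; apply: ordinfB.
    by have := ordinfM O VA; apply: ordinfW; lia.
  by apply: ordinfW (stage_tail st); lia.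
split=> //; apply/eqP => tv; apply: nO.
have Ot : ordinf v.+2%:Z (cauchy t).
  apply/ordinf_cauchy => i; rewrite ltnS leq_eqVlt => /orP[/eqP->//|]; exact: t0.
have OPhi : ordinf v.+2%:Z (remainder s B E / remainder s A C).
  rewrite -[_ / _](subrK (cauchy t)); apply: ordinfD => //.
  by apply: ordinfW (stage_tail st); lia.
rewrite -[remainder s B E](divfK nzA).
by have := ordinfM OPhi (stage_ord st); apply: ordinfW; lia.
Qed.

Hypothesis nzDp : Dp s (k + v.+1) != 0.

(** If the determinant vanished, z m would invert the Cauchy transform of t to
    one order more than usual, so the new first column (A - z m B, C - z m E)
    would have the remainder expected of the second one, and C - z m E would be
    orthogonal to z^i for all i < k + v + 1. It vanishes at 0, hence is zero by
    the hypothesis on the shifted determinant of s; then its column is zero,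
    which contradicts the determinant 1. *)
Lemma stage_next_Dp : Dp t v.+1 != 0.
Proof.
have [t0 nztv] := stage_next_tail; have nzDt := D_leading_zeros t0 nztv.
apply/eqP => Dp0; set m := schur_m t v.+1.
have momm i : (i <= v.+1)%N -> moment t m i = (i == 0)%:R.
  rewrite leq_eqVlt => /orP[/eqP->|lt_iv]; last exact: moment_schur_m.
  by rewrite moment_schur_m_last Dp0 mulr0.
have Ot : ordinf v.+1%:Z (cauchy t) by apply/ordinf_cauchy.
have Om : ordinf (- v%:Z) m%:F by apply: ordinf_polyW; apply: size_schur_m.
have Sm : Sfun t (ddiff m) = 0.
  have O1 : ordinf 1 (m%:F * cauchy t - (Sfun t (ddiff m))%:F).
    by apply/(ordinf_moment _ _ _ 0).
  apply: (ordinf1_eq O1); rewrite rmorph0 subr0.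
  by have := ordinfM Om Ot; apply: ordinfW; lia.
(* As m times the Cauchy transform of t has no polynomial part, the one of
   z m times it is the moment of order 0 of m. *)
have Sz : Sfun t (ddiff (m * 'X)) = 1.
  have := ddiffMXaddC m 0; rewrite addr0 => ->.
  by rewrite SfunD SfunCM Sm mulr0 add0r Sfun_map momm.
have Oz : ordinf v.+2%:Z ((m * 'X)%:F * cauchy t - 1).
  rewrite -(rmorph1 (@FracField.tofrac _)); apply/ordinf_moment; split=> // i lt_i.
  by have := momentMXaddC t m 0 i; rewrite addr0 mul0r addr0 => ->; rewrite momm.
have OzPhi :
    ordinf v.+2%:Z ((m * 'X)%:F * (remainder s B E / remainder s A C) - 1).
  move: Oz (stage_tail st); move: (remainder s B E / _) (cauchy t) => phi c Oz Oc.
  have -> : (m * 'X)%:F * phi - 1 =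
    (m * 'X)%:F * (phi - c) + ((m * 'X)%:F * c - 1) by ring.
  apply: ordinfD => //; rewrite tofracM.
  by have := ordinfM (ordinfM Om (@ordinf_zeta R)) Oc; apply: ordinfW; lia.
have nzA := stage_rest_neq0; have [O _] := stage_next_order.
(* (Q, P) is the first column after multiplication by the next factor M. *)
pose P := C - m * 'X * E; pose Q := A - m * 'X * B.
have OPQ : ordinf (k + v.+1).+1%:Z (P%:F * cauchy s - (- Q)%:F).
  have -> : P%:F * cauchy s - (- Q)%:F =
      - (remainder s A C * ((m * 'X)%:F * (remainder s B E / remainder s A C) - 1)).
    transitivity (remainder s A C - (m * 'X)%:F * remainder s B E).
      by rewrite /remainder /P /Q tofracN !tofracB !tofracM; ring.
    by rewrite mulrBr mulr1 mulrCA [remainder s A C * _]mulrC divfK // opprB.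
  by apply: ordinfN; have := ordinfM (stage_ord st) OzPhi; apply: ordinfW; lia.
have szP : (size P <= (k + v.+1).+1)%N.
  rewrite (leq_trans (size_polyD _ _)) // geq_max size_polyN; apply/andP; split.
    by rewrite (leq_trans (stage_size_C st)) // ltnS leq_addr.
  rewrite (leq_trans (size_polyMleq _ _)) //.
  have := size_polyMleq m 'X; rewrite size_polyX.
  have := stage_size_E st; have := size_schur_m t v; rewrite -/m.
  by move: (size (m * _)) (size m) (size E) => x y e; lia.
have P0 : P = 0.
  elim/poly_ind: {-1}P (erefl P) szP OPQ => // p c _ PE szP.
  have c0 : c = 0.
    have <- : (p * 'X + c%:P)`_0 = c by rewrite coefD coefMX coefC add0r.
    by rewrite -PE coefB (stage_C0 st) mulrAC coefMX subr0.
  rewrite c0 addr0 in PE szP *; case/ordinf_moment=> _ momP.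
  suff -> : p = 0 by rewrite mul0r.
  apply: (@D_ker _ (behead s) (k + v.+1)); first by rewrite -Dp_behead.
    have [->|nzp] := eqVneq p 0; first by rewrite size_poly0.
    by move: szP; rewrite size_mulX.
  by move=> i lt_i; rewrite moment_behead momP.
have Q0 : Q = 0.
  apply: oppr_inj; rewrite oppr0; apply: ordinf1_poly.
  move: OPQ; rewrite P0 rmorph0 mul0r add0r => /ordinfN; rewrite opprK.
  by apply: ordinfW; lia.
have := stage_det st; move/eqP: P0; move/eqP: Q0; rewrite !subr_eq0 => /eqP-> /eqP->.
by move/eqP; rewrite mulrAC [B * _]mulrC mulrAC subrr eq_sym oner_eq0.
Qed.

(** The first remainder becomes minus the old second one times u, and u has
    order 0, so its order is exactly the new Hankel size; the quotient becomes
    l - 1/u, whose expansion is known from schur_step_expansion. *)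
Lemma stage_step (m := schur_m t v.+1) (l := schur_l t v.+1)
    (A' := A - 'X * m * B) (C' := C - 'X * m * E) :
  stage s (k + v.+1) (schur_next t v.+1) A' (l *: A' + B) C' (l *: C' + E).
Proof.
have [t0 nztv] := stage_next_tail; have nzDt := D_leading_zeros t0 nztv.
have stp : schur_step t v.+1 (schur_frak t v.+1) (schur_next t v.+1).
  by apply/schur_stepP; rewrite ?subn1 //; apply: stage_next_Dp.
have := schur_step_expansion sz_t t0 nztv stp (stage_tail st).
rewrite -/m -/l /=; set u := 'X%:F * _ - _ => -[Ou nOu Otail].
have nzA := stage_rest_neq0; have [O nO] := stage_next_order.
have nzB : remainder s B E != 0.
  by apply/eqP => r0; apply: nO; rewrite r0; apply: ordinf0.
have rA : remainder s A' C' = - (remainder s B E * u).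
  transitivity (remainder s A C - 'X%:F * m%:F * remainder s B E).
    by rewrite /remainder !tofracB !tofracM; ring.
  rewrite /u mulrBr opprB invf_div; congr (_ - _); last by rewrite mulrC.
  by rewrite mulrC divfK.
have rB a c : remainder s (l *: a + B) (l *: c + E) =
              l%:P%:F * remainder s a c + remainder s B E.
  by rewrite /remainder -!mul_polyC !tofracD !tofracM; ring.
have nzu : u != 0 by apply/eqP => u0; apply: nOu; rewrite u0; apply: ordinf0.
have szC : (size C' <= (k + v.+1).+1)%N.
  rewrite (leq_trans (size_polyD _ _)) // geq_max size_polyN; apply/andP; split.
    by rewrite (leq_trans (stage_size_C st)) // ltnS leq_addr.
  rewrite (leq_trans (size_polyMleq _ _)) //.
  have := size_polyMleq 'X m; rewrite size_polyX.
  have := stage_size_E st; have := size_schur_m t v; rewrite -/m.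
  by move: (size (_ * m)) (size m) (size E) => x y e; lia.
split=> //.
- rewrite (leq_trans (size_polyD _ _)) // geq_max.
  rewrite (leq_trans (size_scale_leq _ _)) //= (leq_trans (stage_size_E st)) //.
  by rewrite ltnS leq_addr.
- rewrite coefD coefZ coefB (stage_C0 st) (stage_E0 st) -mulrA coefXM.
  by rewrite subr0 mulr0 add0r.
- by rewrite coefB (stage_C0 st) -mulrA coefXM subr0.
- by rewrite -(stage_det st) /A' /C' -!mul_polyC; ring.
- by rewrite rA; apply: ordinfN; rewrite -[_%:Z]addr0; apply: ordinfM.
- rewrite rA => /ordinfN; rewrite opprK => OBu; apply: nO.
  have Vu : ordinf 0 u^-1 by have := @ordinfV _ 0 u; rewrite add0r oppr0; apply.
  by rewrite -[remainder s B E](mulfK nzu) -[_ + 1]addr0; apply: ordinfM.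
have -> : remainder s (l *: A' + B) (l *: C' + E) / remainder s A' C' = l%:P%:F - u^-1.
  by rewrite rB rA (quotient_step (l%:P%:F) nzB nzu).
exact: Otail.
Qed.

End Consequences.
End Stage.

(** * The Stieltjes polynomials *)

Section Wronskian.
Variable R : fieldType.
Implicit Types (s : seq R).

Lemma mx2_mul (T : comNzRingType) (a b c d a' b' c' d' : T) :
  mx2 a b c d *m mx2 a' b' c' d' =
  mx2 (a * a' + b * c') (a * b' + b * d') (c * a' + d * c') (c * b' + d * d').
Proof.
apply/matrixP=> i j; rewrite mxE big_ord_recl big_ord1 !mxE /=.
by case: (i == ord0); case: (j == ord0).
Qed.

Lemma det_mx2 (T : comNzRingType) (a b c d : T) :
  \det (mx2 a b c d) = a * d - b * c.
Proof.
rewrite (expand_det_row _ ord0) big_ord_recl big_ord1 /cofactor !det_mx11 !mxE /=.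
by rewrite expr0 expr1 mul1r mulN1r mulrN.
Qed.

Lemma Ppol0 s : Ppol s 0 = 1.
Proof.
have D0 : D s 0 = 1 by rewrite /D det_mx00.
have := @lead_Ppol _ s 0; rewrite D0 oner_neq0 => /(_ isT) P0.
by rewrite (size1_polyC (size_Ppol s 0)) P0.
Qed.

Lemma Qpol0 s : Qpol s 0 = 0.
Proof.
rewrite /Qpol Ppol0; symmetry.
suff /ordinf_moment[] : ordinf 1%:Z (1%:F * cauchy s - (0 : {poly R})%:F) by [].
by rewrite rmorph1 rmorph0 mul1r subr0; apply/(ordinf_cauchy s 0).
Qed.

(** P is monic of degree v + 1 and sigma starts with s_v z^(-v-1). This gives
    the initial value of the Wronskian. *)
Lemma Qpol_first s v : (forall i, (i < v)%N -> s`_i = 0) -> s`_v != 0 ->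
  Qpol s v.+1 = (s`_v)%:P.
Proof.
move=> s0 nzs; have nzD := D_leading_zeros s0 nzs.
set P := Ppol s v.+1.
have OQ : ordinf 1%:Z (P%:F * cauchy s - (Qpol s v.+1)%:F).
  by apply/ordinf_moment.
apply: (ordinf1_eq OQ).
have -> : P%:F * cauchy s - (s`_v)%:P%:F = (P - 'X^(v.+1))%:F * cauchy s +
    atinf (Poly (drop v s) - (s`_v)%:P).
  rewrite tofracB tofracXn atinfD atinfN atinfC mulrBl {3}(cauchy_drop s0).
  by rewrite (mulrA _ (winf R ^+ _)) -exprMn zetaV expr1n mul1r; ring.
apply: ordinfD; last first.
  apply/(ordinf_atinf 1) => -[|] // _.
  by rewrite coefB coef_Poly coefC nth_drop addn0 subrr.
have OP : ordinf (- v%:Z) (P - 'X^(v.+1))%:F.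
  apply: ordinf_polyW; apply/leq_sizeP => i le_vi; rewrite coefB coefXn.
  have [->|ne_iv] := eqVneq i v.+1; first by rewrite lead_Ppol // subrr.
  rewrite subr0 nth_default // (leq_trans (size_Ppol _ _)) //.
  by rewrite ltn_neqAle eq_sym ne_iv.
have /ordinf_cauchy Os := s0.
by have := ordinfM OP Os; apply: ordinfW; lia.
Qed.

(** The recurrence multiplies the Wronskian by b at each step; starting at
    n 0 = 0, the initial value is - Q at n 1. *)
Lemma wronskian s N n b j :
  n 0%N = 0%N -> recurrence_numbers s N n b ->
  Qpol s (n 1%N) = (b 0%N)%:P -> (j < N)%N ->
  Ppol s (n j.+1) * Qpol s (n j) - Qpol s (n j.+1) * Ppol s (n j) =
  - (\prod_(k < j.+1) b k)%:P.
Proof.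
move=> n0 [_ rec] Q1; elim: j => [|j IHj] lt_jN.
  by rewrite n0 Ppol0 Qpol0 Q1 big_ord1 mulr0 mulr1 sub0r.
have [_ [a [_ _ recP recQ]]] := rec j.+1 lt_jN.
rewrite big_ord_recr /= [_ * b _]mulrC polyCM -[RHS]mulrN -IHj 1?ltnW //=.
have -> : Ppol s (n j.+2) = a * Ppol s (n j.+1) - (b j.+1)%:P * Ppol s (n j).
  by apply/eqP; rewrite -subr_eq0 -recP -mul_polyC; apply/eqP => /=; ring.
have -> : Qpol s (n j.+2) = a * Qpol s (n j.+1) - (b j.+1)%:P * Qpol s (n j).
  by apply/eqP; rewrite -subr_eq0 -recQ -mul_polyC; apply/eqP => /=; ring.
by ring.
Qed.

(** Eliminating A and C from the determinant gives l = - beta / (p0 p1), and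
    then the first column is a difference of consecutive second columns divided
    by l. *)
Lemma first_column (P0 P1 Q0 Q1 A C : {poly R}) (p0 p1 l beta : R) :
  p0 != 0 -> p1 != 0 -> beta != 0 ->
  P1 * Q0 - Q1 * P0 = - beta%:P ->
  p1^-1 *: P1 = l *: C + p0^-1 *: P0 ->
  - (p1^-1 *: Q1) = l *: A - p0^-1 *: Q0 ->
  A * (p1^-1 *: P1) + (p1^-1 *: Q1) * C = 1 ->
  A = (1 / beta) *: (Q1 * p0%:P - Q0 * p1%:P) /\
  C = (- 1 / beta) *: (P1 * p0%:P - P0 * p1%:P).
Proof.
move=> nz0 nz1 nzb W EE BE dt.
(* Multiply the determinant identity by l and substitute for l A and l C. *)
have lE : l = - (p0^-1 * p1^-1 * beta).
  apply: polyC_inj; rewrite -[LHS]mulr1 -dt polyCN polyCM -mulrN -W.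
  transitivity ((l *: A) * (p1^-1 *: P1) + (p1^-1 *: Q1) * (l *: C)).
    by rewrite -!mul_polyC; ring.
  have -> : l *: A = - (p1^-1 *: Q1) + p0^-1 *: Q0 by rewrite BE subrK.
  have -> : l *: C = p1^-1 *: P1 - p0^-1 *: P0 by rewrite EE addrK.
  by rewrite polyCM -!mul_polyC; ring.
have nzl : l != 0.
  by rewrite lE oppr_eq0 !mulf_neq0 ?invr_eq0.
have lV : l^-1 = - (p0 * p1 / beta) by rewrite lE invrN !invfM !invrK.
split.
  have -> : A = l^-1 *: (- (p1^-1 *: Q1) + p0^-1 *: Q0).
    by rewrite BE subrK scalerA mulVf // scale1r.
  rewrite lV scalerDr scalerN !scalerA scalerBr !(mulrC _ (_%:P)) !mul_polyC !scalerA.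
  rewrite -scaleNr -scaleNr; congr (_ *: _ + _ *: _);
    by field; rewrite ?nz0 ?nz1 ?nzb.
have -> : C = l^-1 *: (p1^-1 *: P1 - p0^-1 *: P0).
  by rewrite EE addrK scalerA mulVf // scale1r.
rewrite lV !scalerBr !scalerA !(mulrC _ (_%:P)) !mul_polyC !scalerA.
by rewrite -!scaleNr; congr (_ *: _ + _ *: _); field; rewrite ?nz0 ?nz1 ?nzb.
Qed.

End Wronskian.

Section Main.
Variables (R : fieldType) (N : nat) (n : nat -> nat) (s : seq R) (b : nat -> R).
Hypothesis N_gt0 : (1 <= N)%N.
Hypothesis n0 : n 0%N = 0%N.
Hypothesis n_incr : forall j, (j < N)%N -> (n j < n j.+1)%N.
Hypothesis sz_s : size s = (2 * n N)%N.
Hypothesis normalP :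
  forall k, normal_index s k <-> exists2 j, (1 <= j <= N)%N & k = n j.
Hypothesis reg : regular s.
Hypothesis recb : recurrence_numbers s N n b.

Lemma n_mono i j : (i <= j)%N -> (j <= N)%N -> (n i <= n j)%N.
Proof.
elim: j => [|j IHj]; first by rewrite leqn0 => /eqP->.
rewrite leq_eqVlt => /orP[/eqP->//|lt_ij] lt_jN.
by rewrite (leq_trans (IHj _ (ltnW lt_jN))) // ltnW // n_incr.
Qed.

Lemma D_n_neq0 j : (j <= N)%N -> D s (n j) != 0.
Proof.
case: j => [|j] lt_jN; first by rewrite n0 /D det_mx00 oner_neq0.
by have /and3P[] : normal_index s (n j.+1) by apply/normalP; exists j.+1.
Qed.

Lemma Dp_n_neq0 j : (j < N)%N -> Dp s (n j.+1) != 0.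
Proof. by move=> lt_jN; apply/reg/normalP; exists j.+1. Qed.

Lemma D_gap_eq0 j m : (j < N)%N -> (n j < m)%N -> (m < n j.+1)%N -> D s m = 0.
Proof.
move=> lt_jN lt_m m_lt; apply/eqP; apply: contraTT (m_lt) => nzD.
have /normalP[i /andP[_ le_iN] mE] : normal_index s m.
  rewrite /normal_index nzD (leq_trans _ lt_m) //= sz_s andbT.
  by have := n_mono lt_jN (leqnn N); lia.
rewrite -leqNgt mE n_mono // ltnNge; apply: contraTN lt_m => le_ij.
by rewrite mE -leqNgt n_mono // ltnW.
Qed.

Lemma size_schur_seq j :
  (j <= N)%N -> size (schur_seq s n j) = (2 * (n N - n j))%N.
Proof.
elim: j => [|j IHj] lt_jN; first by rewrite n0 subn0.
rewrite /= size_mkseq IHj; last exact: ltnW.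
by have := n_mono lt_jN (leqnn N); have := n_incr lt_jN; lia.
Qed.

Definition Wstage j A B C E :=
  W_even s n j = mx2 A B C E /\ stage s (n j) (schur_seq s n j) A B C E.

Lemma W_even_step j A B C E (A' := A - 'X * m_ s n j.+1 * B)
    (C' := C - 'X * m_ s n j.+1 * E) (l := l_ s n j.+1) :
  (j < N)%N -> Wstage j A B C E ->
  Wstage j.+1 A' (l *: A' + B) C' (l *: C' + E).
Proof.
move=> lt_jN [WE st]; have lt_n := n_incr lt_jN; split.
  rewrite /W_even big_nat_recr //= -[\prod_(_ <= _ < _) _]/(W_even s n j) WE.
  rewrite -[LHS]/(mx2 A B C E *m (Mmx s n j.+1 *m Lmx s n j.+1)) mulmxA !mx2_mul.
  rewrite -/l /A' /C'; move: (m_ s n j.+1) l => m l; clear.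
  rewrite !(mulr1, mulr0, mul0r, mul1r, addr0, add0r) -!mul_polyC.
  by congr mx2; ring.
have [v nE] : exists v, n j.+1 = (n j + v.+1)%N by exists (n j.+1 - n j).-1; lia.
have nuE : (n j.+1 - n j = v.+1)%N by rewrite nE addKn.
have sz_t : (2 * v.+1 <= size (schur_seq s n j))%N.
  rewrite size_schur_seq ?(ltnW lt_jN) //; have := n_mono lt_jN (leqnn N).
  by rewrite nE; lia.
have gap m : (n j < m)%N -> (m < n j + v.+1)%N -> D s m = 0.
  by rewrite -nE; apply: D_gap_eq0.
have nzD' := D_n_neq0 lt_jN; have nzDp := Dp_n_neq0 lt_jN.
rewrite nE in nzD' nzDp.
have := stage_step st (D_n_neq0 (ltnW lt_jN)) nzD' gap sz_t nzDp.
by rewrite /A' /C' /l /l_ /m_ /= nuE nE.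
Qed.

Lemma W_even_stage j : (j <= N)%N -> exists A B C E, Wstage j A B C E.
Proof.
elim: j => [|j IHj] lt_jN.
  exists 1, 0, 0, 1; split; last by rewrite n0; apply: stage_init.
  rewrite /W_even big_geq //; apply/matrixP=> i k; rewrite !mxE -val_eqE.
  by case: (unliftP ord0 i) => [i' ->|->]; case: (unliftP ord0 k) => [k' ->|->];
     rewrite ?ord1.
have [A [B [C [E st]]]] := IHj (ltnW lt_jN).
by do 4!eexists; apply: W_even_step st.
Qed.

Lemma Qpol_n1 : Qpol s (n 1%N) = (b 0%N)%:P /\ b 0%N != 0.
Proof.
have lt_n := n_incr N_gt0; rewrite n0 in lt_n.
have [v nE] : exists v, n 1%N = v.+1 by exists (n 1%N).-1; lia.
have [s0 nzs] : (forall i, (i < v)%N -> s`_i = 0) /\ s`_v != 0.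
  apply: (stage_next_tail (stage_init s)) => [|||] /=.
  - by rewrite -n0 D_n_neq0.
  - by rewrite add0n -nE D_n_neq0.
  - by move=> m; rewrite add0n -nE -{1}n0; apply: D_gap_eq0.
  - by rewrite sz_s -nE leq_mul2l n_mono.
have [-> _] := recb; rewrite nE subn1 /=; split=> //.
exact: Qpol_first.
Qed.

Lemma prod_b_neq0 j : (j < N)%N -> \prod_(k < j.+1) b k != 0.
Proof.
have [_ nzb0] := Qpol_n1; move=> lt_jN; apply/prodf_neq0 => -[[|k] lt_k] _ //=.
by have [] := recb.2 k.+1 (leq_trans lt_k lt_jN).
Qed.

Lemma W_even_Stieltjes j : (j <= N)%N ->
  W_even s n j =
    mx2 (Qplus s n b (2 * j%:Z - 1)) (Qplus s n b (2 * j%:Z))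
        (Pplus s n b (2 * j%:Z - 1)) (Pplus s n b (2 * j%:Z)).
Proof.
case: j => [|j] lt_jN.
  rewrite /W_even big_geq //; apply/matrixP=> i k; rewrite !mxE -val_eqE.
  by case: (unliftP ord0 i) => [i' ->|->]; case: (unliftP ord0 k) => [k' ->|->];
     rewrite ?ord1.
have -> : 2 * j.+1%:Z - 1 = Posz j.*2.+1 by lia.
have -> : 2 * j.+1%:Z = Posz j.*2.+2 by lia.
rewrite /Qplus /Pplus /= odd_double /= doubleK uphalf_double.
have [A [B [C [E st]]]] := W_even_stage (ltnW lt_jN).
have [WE st'] := W_even_step lt_jN st.
have [nz1 EE BE] := stage_Ppol st' (D_n_neq0 lt_jN).
have [nz0 EE0 BE0] := stage_Ppol st.2 (D_n_neq0 (ltnW lt_jN)).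
have dt := stage_det st'; rewrite WE.
move: EE BE dt; set A' := A - _; set C' := C - _ => EE BE dt.
have W := wronskian n0 recb Qpol_n1.1 lt_jN.
have [|||AE CE] := first_column nz0 nz1 (prod_b_neq0 lt_jN) W
  (l := l_ s n j.+1) (A := A') (C := C').
- by rewrite -EE -EE0.
- by rewrite -BE -BE0.
- by rewrite -[RHS]dt EE BE mulNr opprK.
rewrite -/A' -/C' /Qplus_odd /Pplus_odd /Qplus_even /Pplus_even !det_mx2.
by rewrite -AE -CE EE BE.
Qed.

End Main.

Theorem lemma5p8 (R : realType) (N : nat) (n : nat -> nat) (s : seq R)
    (b : nat -> R) :
  (1 <= N)%N ->
  n 0%N = 0%N ->
  (forall j, (j < N)%N -> (n j < n j.+1)%N) ->
  size s = (2 * n N)%N ->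
  (forall k, normal_index s k <-> exists2 j, (1 <= j <= N)%N & k = n j) ->
  regular s ->
  recurrence_numbers s N n b ->
  forall j, (j <= N)%N ->
    W_even s n j =
      mx2 (Qplus s n b (2 * j%:Z - 1)) (Qplus s n b (2 * j%:Z))
          (Pplus s n b (2 * j%:Z - 1)) (Pplus s n b (2 * j%:Z)).
Proof. exact: W_even_Stieltjes. Qed.
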